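(* Let $G$ be a twin-free, connected proper circular-arc graph. (1) If $\overline{G}$ is non-bipartite, then $\mathcal{N}[G]$ has, up to reversal, a unique arc ordering. (2) If $\overline{G}$ is bipartite and connected, then $\mathcal{N}[G]$ has, up to reversal, exactly two tight arc orderings.
   Context: Vertices $u\ne v$ of $G$ are twins if $N[u]=N[v]$ (closed neighborhoods); $G$ is twin-free if it has none. $\mathcal{N}[G]$ is the hypergraph on $V=V(G)$ with hyperedges $N[v]$, $v\in V$. A PCA graph is one having a representation by arcs of a circle, adjacency meaning intersection, in which no arc is contained in another. An arc ordering of a hypergraph on $V$ is a circular ordering of $V$ in which every hyperedge is a set of circularly consecutive vertices (an arc); it is tight if for any hyperedges $A,B$ with $\emptyset\neq A\subseteq B\neq V$ the arcs $A,B$ share an endpoint. Up to reversal means up to reversing the circular order.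
   Formalization: Part (2) is stated for graphs with at least two vertices, since it fails for the one-vertex graph K_1, whose complement is bipartite and connected but which has only one circular ordering. *)

(* Defs.v *)
From mathcomp Require Import all_boot all_order all_algebra all_fingroup.
From mathcomp Require Import reals.

Set Implicit Arguments.
Unset Strict Implicit.
Unset Printing Implicit Defensive.

Import Order.TTheory GRing.Theory Num.Theory.

(* A finite simple graph is a symmetric irreflexive relation on a finType. *)

Section Graphs.

Variables (T : finType) (e : rel T).

Definition connected_graph : Prop := forall u v, connect e u v.

Definition compl_graph : rel T := [rel u v | (u != v) && ~~ e u v].

Definition bipartite : Prop :=
  exists side : T -> bool, forall u v, e u v -> side u != side v.

Definition closed_nbh (v : T) : {set T} := [set u | (u == v) || e v u].

Definition twin_free : Prop :=
  forall u v, u != v -> closed_nbh u != closed_nbh v.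

Definition nbh_hypergraph : {set {set T}} := [set closed_nbh v | v : T].

End Graphs.

(* The circle is R/Z, with [0, 1[ as set of representatives.  For endpoints
   a, b in [0, 1[, [circle_arc a b] is the closed arc run through in the
   positive direction from a to b; it passes through 0 when b < a, and it is
   the single point a when a = b. *)

Section ProperCircularArc.

Local Open Scope ring_scope.

Variable R : realType.

Definition on_circle : pred R := [pred x | 0 <= x < 1].

Definition circle_arc (a b : R) : pred R :=
  [pred x | on_circle x &
            if a <= b then a <= x <= b else (a <= x) || (x <= b)].

Definition proper_circular_arc (T : finType) (e : rel T) : Prop :=
  exists l r : T -> R,
    [/\ forall v, on_circle (l v) /\ on_circle (r v),
        forall u v, u != v ->
          (e u v <->
           exists x, x \in circle_arc (l u) (r u) /\
                     x \in circle_arc (l v) (r v))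
      & forall u v, u != v ->
          ~ {subset circle_arc (l u) (r u) <= circle_arc (l v) (r v)}].

End ProperCircularArc.

(* A circular ordering of T is given by its successor function, a permutation
   with a single cycle; the reversed ordering is then the inverse permutation. *)

Section ArcOrderings.

Variable T : finType.

Implicit Types (s : {perm T}) (A B : {set T}) (H : {set {set T}}).

Definition circular s : bool := [forall x, forall y, fconnect s x y].

(* The vertices met when going from a to b along s. *)
Definition vertex_arc s (a b : T) : {set T} :=
  [set iter k s a | k : 'I_(findex s a b).+1].

Definition is_arc s A : bool :=
  (A == set0) || [exists a, exists b, A == vertex_arc s a b].

Definition arc_ordering H s : bool :=
  circular s && [forall A in H, is_arc s A].

(* In a circular ordering, a nonempty arc other than [set: T] has a unique
   first and a unique last vertex, so that quantifying over pairs of endpoints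
   is unambiguous for A \subset B != [set: T]. *)
Definition tight H s : bool :=
  [forall a, forall b, forall c, forall d,
    let A := vertex_arc s a b in
    let B := vertex_arc s c d in
    [&& A \in H, B \in H, A != set0, A \subset B & B != [set: T]]
      ==> (a == c) || (b == d)].

Definition tight_arc_ordering H s : bool := arc_ordering H s && tight H s.

(* The number of circular orderings satisfying P, where an ordering and its
   reversal are counted once. *)
Definition count_up_to_reversal (P : pred {perm T}) : nat :=
  #|[set [set s; s^-1%g] | s : {perm T} & P s]|.

End ArcOrderings.

(* Main.v *)
(* Write K(v) for the complement of N[v], i.e. the neighbourhood of v in the
   complement graph.  A proper arc model, read by left endpoints, gives a tight
   arc ordering s0.  Describe arcs by the pair of cuts of s0 bounding them.  In
   any other arc ordering s the arcs are closed under complement and under the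
   Boolean operations on crossing arcs, so that the cuts bounding crossing
   s-arcs are pairwise boundaries of s-arcs; hence a maximal clique of cuts,
   two of which always bound an s-arc, is not crossed by any K(v).  When the
   complement graph is not bipartite, every s0-arc with at least two vertices
   inside and outside is crossed by some K(v), so the clique contains all cuts,
   s0-consecutive vertices are s-consecutive, and s is s0 or its reversal.
   When the complement graph is connected and bipartite, connectedness makes
   its two sides arcs of every arc ordering; tightness adds differences of
   nested hyperedges to the s-arcs, and the same argument within each side
   leaves, for each side, only its s0-order and the reverse.  All four choices
   are tight since K(v) always lies within one side. *)

Require Import Defs.
From mathcomp Require Import all_boot all_order all_algebra all_fingroup.
From mathcomp Require Import reals.
From mathcomp Require Import zify lra.

Set Implicit Arguments.
Unset Strict Implicit.
Unset Printing Implicit Defensive.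

(** * Circular orderings as numberings of the vertices *)

Section Positions.

Variable T : finType.
Implicit Types (s : {perm T}) (pos : T -> nat) (A B : {set T}).

Definition numbering pos := injective pos /\ forall v, pos v < #|T|.

Definition turns s pos := forall v,
  (pos (s v) == (pos v).+1) || ((pos v).+1 == #|T|) && (pos (s v) == 0).

Definition rotation k pos pos' := forall v,
  (pos v < k) && (pos' v == pos v + #|T| - k) ||
  (k <= pos v) && (pos' v == pos v - k).

Definition itv pos a b : {set T} := [set v | a <= pos v < b].

Lemma pos_surj pos i : numbering pos -> i < #|T| -> exists v, pos v = i.
Proof.
move=> [pos_inj pos_lt] ilt.
pose f v := Ordinal (pos_lt v).
have f_inj : injective f by move=> u v /(congr1 val) /pos_inj.
have card_le : #|'I_#|T| | <= #|T| by rewrite card_ord.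
have [g _ fK] := inj_card_bij f_inj card_le.
by exists (g (Ordinal ilt)); exact: (congr1 val (fK (Ordinal ilt))).
Qed.

Lemma numbering_turn s p :
  circular s -> exists pos, [/\ numbering pos, turns s pos & pos p = 0].
Proof.
move=> /forallP circ.
have conn x y : fconnect s x y by move/forallP: (circ x); apply.
have ordE : fingraph.order s p = #|T|.
  by apply: eq_card => x; rewrite inE; exact: conn.
exists (findex s p); split; first split.
- by move=> u v uv; rewrite -(iter_findex (conn p u)) uv iter_findex.
- by move=> v; rewrite -ordE; apply: findex_max; exact: conn.
- move=> v; have vE := iter_findex (conn p v).
  have lt := findex_max (conn p v).
  have sv : s v = iter (findex s p v).+1 s p by rewrite iterS vE.
  rewrite -ordE; have [eq_ord|ne_ord] := eqVneq (findex s p v).+1 (fingraph.order s p).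
    by rewrite sv eq_ord iter_order ?findex0 ?orbT //; exact: perm_inj.
  by rewrite {1}sv findex_iter ?eqxx // ltn_neqAle lt ne_ord.
- by rewrite findex0.
Qed.

Lemma turn_numbering pos :
  numbering pos -> exists s, circular s /\ turns s pos.
Proof.
move=> num; have [pos_inj pos_lt] := num.
have ex v : exists u, (pos u == (pos v).+1) || ((pos v).+1 == #|T|) && (pos u == 0).
  have vlt := pos_lt v; have [vn|vn] := eqVneq (pos v).+1 #|T|.
    have [u uE] : exists u, pos u = 0 by apply: (pos_surj num); lia.
    by exists u; rewrite uE orbT.
  have [u uE] : exists u, pos u = (pos v).+1 by apply: (pos_surj num); lia.
  by exists u; rewrite uE eqxx.
pose f v := xchoose (ex v).
have fE v : _ := xchooseP (ex v).
have f_inj : injective f.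
  move=> u v uv; apply: pos_inj; have := fE u; have := fE v; rewrite -/(f u) -/(f v) uv.
  by have := pos_lt u; have := pos_lt v; have := pos_lt (f v); lia.
exists (perm f_inj); have tE : turns (perm f_inj) pos by move=> v; rewrite permE fE.
split; last exact: tE.
have up k x y : pos y = pos x + k -> fconnect (perm f_inj) x y.
  elim: k x => [|k IH] x yE; first by rewrite (pos_inj x y) //; lia.
  apply: connect_trans (fconnect1 _ x) _; apply: IH; have := tE x.
  by have := pos_lt y; lia.
apply/forallP => x; apply/forallP => y.
have n_gt0 : 0 < #|T| by have := pos_lt x; lia.
have [z z0] : exists z, pos z = 0 by apply: (pos_surj num).
have [t tl] : exists t, pos t = #|T|.-1 by apply: (pos_surj num); rewrite // prednK.
apply: (@connect_trans _ _ t); first by apply: (up (pos t - pos x)); have := pos_lt x; lia.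
apply: (@connect_trans _ _ z); last by apply: (up (pos y)); lia.
have -> : z = perm f_inj t by apply: pos_inj; have := tE t; have := pos_lt (perm f_inj t); lia.
exact: fconnect1.
Qed.

Lemma turns_uniq s s' pos :
  numbering pos -> turns s pos -> turns s' pos -> s = s'.
Proof.
move=> [pos_inj pos_lt] ts ts'; apply/permP => v; apply: pos_inj.
by have := ts v; have := ts' v; have := pos_lt (s v); have := pos_lt (s' v); lia.
Qed.

Lemma numbering_rotation pos k : numbering pos -> k < #|T| ->
  exists pos', numbering pos' /\ rotation k pos pos'.
Proof.
move=> [pos_inj pos_lt] k_lt.
pose pos' v := if pos v < k then pos v + #|T| - k else pos v - k.
have rE : rotation k pos pos' by move=> v; rewrite /pos'; case: ltnP => ? /=; rewrite ?eqxx.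
exists pos'; split=> //; split=> [u v uv|v].
  by apply: pos_inj; have := rE u; have := rE v; have := pos_lt u; have := pos_lt v; lia.
by have := rE v; have := pos_lt v; lia.
Qed.

Lemma turns_rotation s pos pos' k : numbering pos -> k < #|T| -> turns s pos ->
  rotation k pos pos' -> turns s pos'.
Proof.
move=> [_ pos_lt] k_lt ts rE v; have := rE v; have := rE (s v); have := ts v.
by have := pos_lt v; lia.
Qed.

Lemma vertex_arcE s a b pos : circular s -> numbering pos -> turns s pos ->
  pos a = 0 -> vertex_arc s a b = [set v | pos v <= pos b].
Proof.
move=> /forallP circ [pos_inj pos_lt] ts a0.
have conn x y : fconnect s x y by move/forallP: (circ x); apply.
have ordE : fingraph.order s a = #|T|.
  by apply: eq_card => x; rewrite inE; exact: conn.
have itE k : k < #|T| -> pos (iter k s a) = k.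
  elim: k => [|k IH] klt //=; have := ts (iter k s a); rewrite IH; lia.
have fiE v : findex s a v = pos v.
  by rewrite -{2}(iter_findex (conn a v)) itE // -ordE findex_max.
apply/setP => v; rewrite inE /vertex_arc fiE; apply/imsetP/idP => [[k _ ->]|vb].
  rewrite itE; first by rewrite -ltnS.
  by apply: leq_trans (ltn_ord k) _.
by exists (inord (pos v)); rewrite // inordK // -fiE iter_findex.
Qed.

Lemma is_arcP s pos A : circular s -> numbering pos -> turns s pos ->
  is_arc s A <-> exists a b, A = itv pos a b \/ A = ~: itv pos a b.
Proof.
move=> circ num ts; have [pos_inj pos_lt] := num; split.
  case/orP => [/eqP ->|/existsP [a /existsP [b /eqP ->]]].
    by exists 0, 0; left; apply/setP => v; rewrite !inE; lia.
  have [pos' [num' rE]] := numbering_rotation num (pos_lt a).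
  have ts' := turns_rotation num (pos_lt a) ts rE.
  rewrite (vertex_arcE b circ num' ts'); last by have := rE a; lia.
  case: (leqP (pos a) (pos b)) => ab.
    exists (pos a), (pos b).+1; left; apply/setP => v; rewrite !inE.
    by have := rE v; have := rE b; have := pos_lt v; have := pos_lt a; have := pos_lt b; lia.
  exists (pos b).+1, (pos a); right; apply/setP => v; rewrite !inE.
  by have := rE v; have := rE b; have := pos_lt v; have := pos_lt a; have := pos_lt b; lia.
move=> [a [b AE]].
have [->|/set0Pn [x xA]] := eqVneq A set0; first by rewrite /is_arc eqxx.
have xlt := pos_lt x.
apply/orP; right.
suff [i [j [ilt jlt E]]] : exists i j, [/\ i < #|T|, j < #|T| &
   A = if i <= j then [set v | i <= pos v <= j]
       else [set v | (i <= pos v) || (pos v <= j)]].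
  have [u uE] := pos_surj num ilt; have [w wE] := pos_surj num jlt.
  apply/existsP; exists u; apply/existsP; exists w; apply/eqP.
  have [pos' [num' rE]] := numbering_rotation num ilt.
  have ts' := turns_rotation num ilt ts rE.
  rewrite (vertex_arcE w circ num' ts'); last by have := rE u; lia.
  rewrite E; apply/setP => v.
  by case: ifP => ij; rewrite !inE; have := pos_lt v; have := rE v; have := rE w; lia.
case: AE => AE; move: xA; rewrite AE !inE => xA.
  exists a, (minn b #|T|).-1; split; try lia.
  rewrite ifT; last by lia.
  by rewrite ?leq0n; apply/setP => v; rewrite !inE; have := pos_lt v; lia.
case: (leqP b a) => ab.
  exists 0, #|T|.-1; split; try lia.
  by rewrite ?leq0n; apply/setP => v; rewrite !inE; have := pos_lt v; lia.
case: (posnP a) => a0.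
  exists b, #|T|.-1; split; try lia.
  rewrite ifT; last by lia.
  by rewrite ?leq0n; apply/setP => v; rewrite !inE; have := pos_lt v; lia.
case: (ltnP b #|T|) => bn.
  exists b, a.-1; split; try lia.
  rewrite ifF; last by lia.
  by rewrite ?leq0n; apply/setP => v; rewrite !inE; have := pos_lt v; lia.
exists 0, (minn a #|T|).-1; split; try lia.
by rewrite leq0n; apply/setP => v; rewrite !inE; have := pos_lt v; lia.
Qed.

Lemma circular_numbering s :
  circular s -> exists pos, numbering pos /\ turns s pos.
Proof.
move=> circ; have [p _|T0] := pickP (@predT T).
  by have [pos [num ts _]] := numbering_turn p circ; exists pos.
by exists (fun=> 0); split; [split => v|move=> v]; have := T0 v.
Qed.

Lemma is_arcC s A : circular s -> is_arc s A -> is_arc s (~: A).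
Proof.
move=> circ; have [pos [num ts]] := circular_numbering circ.
move=> /(is_arcP _ circ num ts) [a [b AE]]; apply/(is_arcP _ circ num ts).
by exists a, b; case: AE => ->; [right|left; rewrite setCK].
Qed.

Lemma is_arc_itv s A p pos : circular s -> numbering pos -> turns s pos ->
  is_arc s A -> pos p = 0 -> p \notin A ->
  exists a b, b <= #|T| /\ A = itv pos a b.
Proof.
move=> circ num ts arcA p0; move: (arcA) => /(is_arcP _ circ num ts) [a [b [->|->]]].
  exists a, (minn b #|T|); split; first exact: geq_minr.
  by apply/setP => v; rewrite !inE; have := num.2 v; lia.
rewrite !inE p0 => pA; exists b, #|T|; split => //; apply/setP => v; rewrite !inE.
by have := num.2 v; lia.
Qed.

Lemma itv_sub pos a b a' b' : numbering pos -> a < b -> b <= #|T| ->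
  itv pos a b \subset itv pos a' b' -> a' <= a /\ b <= b'.
Proof.
move=> num ab bn /subsetP sub.
have [u ua] : exists u, pos u = a by apply: (pos_surj num); lia.
have [v vb] : exists v, pos v = b.-1 by apply: (pos_surj num); lia.
by have := sub u; have := sub v; rewrite !inE ua vb; lia.
Qed.

(* Cutting the circle at a vertex outside two arcs turns them into intervals. *)
Lemma overlap_arcs s A B p z : circular s -> is_arc s A -> is_arc s B ->
  p \notin A :|: B -> z \in A :&: B ->
  is_arc s (A :&: B) /\ is_arc s (A :|: B).
Proof.
move=> circ arcA arcB; rewrite !inE negb_or => /andP [pA pB] /andP [zA zB].
have [pos [num ts p0]] := numbering_turn p circ.
have [a [b [_ AE]]] := is_arc_itv circ num ts arcA p0 pA.
have [c [d [_ BE]]] := is_arc_itv circ num ts arcB p0 pB.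
move: zA zB; rewrite AE BE !inE => zA zB.
split; apply/(is_arcP _ circ num ts).
  by exists (maxn a c), (minn b d); left; apply/setP => v; rewrite !inE; lia.
by exists (minn a c), (maxn b d); left; apply/setP => v; rewrite !inE; lia.
Qed.

Lemma crossing_itv s pos a b c d : circular s -> numbering pos ->
  a < b -> b < c -> c < d -> d < #|T| ->
  is_arc s (itv pos a c) -> is_arc s (itv pos b d) ->
  [/\ is_arc s (itv pos a b), is_arc s (itv pos b c),
      is_arc s (itv pos c d) & is_arc s (itv pos a d)].
Proof.
move=> circ num ab bc cd dn arcA arcB.
have [u ua] : exists u, pos u = a by apply: (pos_surj num); lia.
have [v vb] : exists v, pos v = b by apply: (pos_surj num); lia.
have [x xc] : exists x, pos x = c by apply: (pos_surj num); lia.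
have [y yd] : exists y, pos y = d by apply: (pos_surj num).
have arcA' := is_arcC circ arcA; have arcB' := is_arcC circ arcB.
have inA z : (z \in itv pos a c) = (a <= pos z < c) by rewrite inE.
have inB z : (z \in itv pos b d) = (b <= pos z < d) by rewrite inE.
have [||I U] := @overlap_arcs s _ _ y v circ arcA arcB.
- rewrite !inE; lia.
- rewrite !inE; lia.
have [||I1 _] := @overlap_arcs s _ _ x u circ arcA arcB'.
- rewrite inE in_setC inA inB xc; lia.
- rewrite inE in_setC inA inB ua; lia.
have [||I2 _] := @overlap_arcs s _ _ u x circ arcA' arcB.
- rewrite inE in_setC inA inB ua; lia.
- rewrite inE in_setC inA inB xc; lia.
clear -ab bc cd I U I1 I2; split.
- suff <- : itv pos a c :&: ~: itv pos b d = itv pos a b by [].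
  apply/setP => z; rewrite !inE; lia.
- suff <- : itv pos a c :&: itv pos b d = itv pos b c by [].
  apply/setP => z; rewrite !inE; lia.
- suff <- : ~: itv pos a c :&: itv pos b d = itv pos c d by [].
  apply/setP => z; rewrite !inE; lia.
- suff <- : itv pos a c :|: itv pos b d = itv pos a d by [].
  apply/setP => z; rewrite !inE; lia.
Qed.

(* Cut i lies just before the vertex numbered i; a chord is one of the two sides
   of an unordered pair of cuts. *)
Definition chord pos a b := itv pos (minn a b) (maxn a b).

Definition crossing a b c d :=
  (minn a b < minn c d < maxn a b) && (maxn a b < maxn c d) ||
  (minn c d < minn a b < maxn c d) && (maxn c d < maxn a b).

Lemma chordC pos a b : chord pos a b = chord pos b a.
Proof. by rewrite /chord minnC maxnC. Qed.

Lemma chord_leq pos a b : a <= b -> chord pos a b = itv pos a b.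
Proof. by move=> ab; rewrite /chord (minn_idPl ab) (maxn_idPr ab). Qed.

Lemma is_arc_chord_refl s pos a : is_arc s (chord pos a a).
Proof. by apply/orP; left; rewrite chord_leq //; apply/eqP/setP => v; rewrite !inE; lia. Qed.

Lemma crossing_either a b x y u : crossing a b x y -> u != x -> u != y ->
  crossing u a x y || crossing u b x y.
Proof.
rewrite /crossing.
by case: (leqP a b) => ?; case: (leqP x y) => ?; case: (leqP u a) => ?; case: (leqP u b) => ?; lia.
Qed.

Lemma crossing_chord s pos a b c d : circular s -> numbering pos ->
  a < #|T| -> b < #|T| -> c < #|T| -> d < #|T| -> crossing a b c d ->
  is_arc s (chord pos a b) -> is_arc s (chord pos c d) ->
  is_arc s (chord pos a c).
Proof.
move=> circ num an bn cn dn cr.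
have rule i j k l : i < j -> j < k -> k < l -> l < #|T| ->
    is_arc s (chord pos i k) -> is_arc s (chord pos j l) ->
    [/\ is_arc s (chord pos i j), is_arc s (chord pos j k),
        is_arc s (chord pos k l) & is_arc s (chord pos i l)].
  move=> ij jk kl ln.
  by rewrite !chord_leq; [exact: crossing_itv|lia..].
move: cr; rewrite /crossing.
case: (leqP a b) => ab; case: (leqP c d) => cd /orP [] /andP [/andP [o1 o2] o3] Pab Pcd.
- by have [] := rule a c b d o1 o2 o3 dn Pab Pcd.
- by have [] := rule c a d b o1 o2 o3 bn Pcd Pab; rewrite (chordC _ a c).
- by rewrite chordC in Pcd; have [] := rule a d b c o1 o2 o3 cn Pab Pcd.
- by rewrite chordC in Pcd; have [] := rule d a c b o1 o2 o3 bn Pcd Pab.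
- by rewrite chordC in Pab; have [] := rule b c a d o1 o2 o3 dn Pab Pcd; rewrite (chordC _ a c).
- by rewrite chordC in Pab; have [] := rule c b d a o1 o2 o3 an Pcd Pab; rewrite (chordC _ a c).
- by rewrite chordC in Pab; rewrite chordC in Pcd; have [] := rule b d a c o1 o2 o3 cn Pab Pcd.
- rewrite chordC in Pab; rewrite chordC in Pcd.
  by have [] := rule d b c a o1 o2 o3 an Pcd Pab; rewrite (chordC _ a c).
Qed.

Definition arc_clique s pos (W S : {set 'I_#|T|}) :=
  (S \subset W) && [forall a in S, forall b in S, is_arc s (chord pos a b)].

Lemma arc_cliqueP s pos W S a b :
  arc_clique s pos W S -> a \in S -> b \in S -> is_arc s (chord pos a b).
Proof. by case/andP => _ /forall_inP cl aS bS; move/forall_inP: (cl a aS); apply. Qed.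

Lemma maxset_arc_clique s pos W S x : maxset (arc_clique s pos W) S ->
  x \in W -> (forall u, u \in S -> is_arc s (chord pos x u)) -> x \in S.
Proof.
case/maxsetP => clS maxS xW xP; rewrite -(maxS (x |: S)) ?setU11 ?subsetUr //.
apply/andP; split; first by rewrite subUset sub1set xW; case/andP: clS.
apply/forall_inP => a /setU1P aP; apply/forall_inP => b /setU1P bP.
case: aP => [->|aS]; case: bP => [->|bS].
- exact: is_arc_chord_refl.
- exact: xP.
- by rewrite chordC; exact: xP.
exact: arc_cliqueP clS aS bS.
Qed.


Lemma crossing_maxset s pos W S (a b x y : 'I_#|T|) : circular s -> numbering pos ->
  maxset (arc_clique s pos W) S -> a \in S -> b \in S -> x \in W ->
  crossing a b x y -> is_arc s (chord pos x y) -> x \in S.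
Proof.
move=> circ num maxS aS bS xW cr xy; apply: (maxset_arc_clique maxS xW) => u uS.
have clS : arc_clique s pos W S by case/maxsetP: maxS.
have [->|uy] := eqVneq u y; first exact: xy.
have [->|ux] := eqVneq u x; first exact: is_arc_chord_refl.
have := crossing_either cr ux uy; rewrite chordC; case/orP => cr'.
  exact: (crossing_chord circ num (ltn_ord _) (ltn_ord _) (ltn_ord _) (ltn_ord _)
    cr' (arc_cliqueP clS uS aS) xy).
exact: (crossing_chord circ num (ltn_ord _) (ltn_ord _) (ltn_ord _) (ltn_ord _)
    cr' (arc_cliqueP clS uS bS) xy).
Qed.

(* For arcs A \subset B <> setT, this says that A and B share an endpoint. *)
Definition touching s A B := [exists x in A, (s x \notin B) || (s^-1%g x \notin B)].

Lemma tight_touching (H : {set {set T}}) s A B : circular s -> arc_ordering H s ->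
  tight H s -> A \in H -> B \in H -> A != set0 -> A \subset B -> B != setT ->
  touching s A B.
Proof.
move=> circ /andP [_ /forall_inP arcH] tH AH BH A0 AB BT.
have B0 : B != set0 by apply: contraNneq A0 => B0; rewrite -subset0 -B0.
move: (arcH A AH) (arcH B BH); rewrite /is_arc (negPf A0) (negPf B0) /=.
case/existsP => a /existsP [b /eqP AE] /existsP [c /existsP [d /eqP BE]].
move: (tH) => /forallP /(_ a) /forallP /(_ b) /forallP /(_ c) /forallP /(_ d).
rewrite /= -AE -BE AH BH A0 AB BT => ends.
have [posA [numA tsA a0]] := numbering_turn a circ.
have [posB [numB tsB c0]] := numbering_turn c circ.
have [z zB] : exists z, z \notin B.
  apply/existsP; apply: contraNT BT => /existsPn zB.
  by rewrite eqEsubset subsetT; apply/subsetP => z _; have := zB z; rewrite negbK.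
have BE' := vertex_arcE d circ numB tsB c0; have AE' := vertex_arcE b circ numA tsA a0.
move: zB; rewrite BE BE' inE => zB.
case/orP: ends => /eqP ends.
  apply/existsP; exists a; rewrite AE AE' inE a0 leq0n /=; apply/orP; right.
rewrite inE -ltnNge; have := tsB (s^-1%g c); rewrite permKV -ends.
  by have := numB.2 z; have := numB.2 (s^-1%g c); rewrite ends c0; clear -zB; lia.
apply/existsP; exists b; rewrite AE AE' inE leqnn /=; apply/orP; left.
rewrite inE -ltnNge ends; have := tsB d; have := numB.2 z; clear -zB; lia.
Qed.

Lemma touching_tight (H : {set {set T}}) s : circular s ->
  (forall A B, A \in H -> B \in H -> A != set0 -> A \subset B -> B != setT ->
     touching s A B) -> tight H s.
Proof.
move=> circ touch; apply/forallP => a; apply/forallP => b; apply/forallP => c.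
apply/forallP => d /=; apply/implyP => /and5P [AH BH A0 AB BT].
have /existsP [x /andP [xA out]] := touch _ _ AH BH A0 AB BT.
have [posA [numA tsA a0]] := numbering_turn a circ.
have [posB [numB tsB c0]] := numbering_turn c circ.
have xB := subsetP AB x xA; have sub := fun y => subsetP AB y.
move: xA xB out sub.
rewrite (vertex_arcE b circ numA tsA a0) (vertex_arcE d circ numB tsB c0) !inE => xA xB out sub.
apply/orP; case/orP: out => out.
  right; have := sub (s x); rewrite !inE (negPf out) => /contraFN/(_ erefl) outA.
  have -> : b = x by apply: numA.1; have := tsA x; lia.
  by apply/eqP; apply: numB.1; have := tsB x; lia.
left; have := sub (s^-1%g x); rewrite !inE (negPf out) => /contraFN/(_ erefl) outA.
have := tsA (s^-1%g x); have := tsB (s^-1%g x); rewrite permKV => tB tA.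
have -> : a = x by apply: numA.1; have := numA.2 (s^-1%g x); have := numA.2 b; lia.
by apply/eqP; apply: numB.1; have := numB.2 (s^-1%g x); have := numB.2 d; lia.
Qed.

Lemma touching_itv s pos A B a b a' b' : circular s -> numbering pos -> turns s pos ->
  ~: A = itv pos a' b' -> ~: B = itv pos a b -> A != set0 ->
  a' <= a -> a < b -> b <= b' -> b' <= #|T| ->
  touching s A B <-> a = a' \/ b = b'.
Proof.
move=> circ num ts AE BE A0 aa ab bb bn.
have inA v : (v \in A) = ~~ (a' <= pos v < b') by rewrite -[A]setCK AE !inE.
have inB v : (v \in B) = ~~ (a <= pos v < b) by rewrite -[B]setCK BE !inE.
have /set0Pn [z zA] := A0; rewrite inA in zA; have zn := num.2 z.
split=> [/existsP [x]|].
  rewrite inA !inB !negbK; have := ts x; have := ts (s^-1%g x); rewrite permKV.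
  by have := num.2 x; have := num.2 (s x); have := num.2 (s^-1%g x); lia.
case=> E.
  have [x xE] : exists x, pos x = a by apply: (pos_surj num); lia.
  apply/existsP; exists (s^-1%g x); rewrite inA !inB permKV.
  have := ts (s^-1%g x); rewrite permKV; have := num.2 (s^-1%g x); lia.
have [x xE] : exists x, pos x = b.-1 by apply: (pos_surj num); lia.
apply/existsP; exists (s x); rewrite inA !inB permK.
have := ts x; have := num.2 (s x); lia.
Qed.

Lemma tight_diff (H : {set {set T}}) s A B : circular s -> arc_ordering H s ->
  tight H s -> A \in H -> B \in H -> A != set0 -> A \subset B -> B != setT ->
  is_arc s (B :\: A).
Proof.
move=> circ ordH tH AH BH A0 AB BT.
have touch := tight_touching circ ordH tH AH BH A0 AB BT.
have /set0Pn [p pA] := A0.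
have [pos [num ts p0]] := numbering_turn p circ.
have pB := subsetP AB p pA.
case/andP: ordH => _ /forall_inP arcH.
have [|a' [b' [b'n AE]]] := is_arc_itv circ num ts (is_arcC circ (arcH A AH)) p0.
  by rewrite inE pA.
have [|a [b [bn BE]]] := is_arc_itv circ num ts (is_arcC circ (arcH B BH)) p0.
  by rewrite inE pB.
have ab : a < b.
  rewrite ltnNge; apply: contraNN BT => ba.
  rewrite -[B]setCK BE -setC0; apply/eqP; congr (~: _).
  apply/setP => z; rewrite !inE; clear -ba; lia.
have [a'a bb'] : a' <= a /\ b <= b' by apply: (itv_sub num ab bn); rewrite -AE -BE setCS.
apply/(is_arcP _ circ num ts).
have -> : B :\: A = itv pos a' b' :\: itv pos a b by rewrite -AE -BE setDE setDE setCK setIC.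
have [eq|eq] := (touching_itv circ num ts AE BE A0 a'a ab bb' b'n).1 touch.
  by exists b, b'; left; apply/setP => z; rewrite !inE; clear -eq a'a ab bb'; lia.
by exists a', a; left; apply/setP => z; rewrite !inE; clear -eq a'a ab bb'; lia.
Qed.

Lemma is_arc_pair s u w : circular s -> u != w -> is_arc s [set u; w] -> s u = w \/ s w = u.
Proof.
move=> circ uw arcU.
have [pos [num ts u0]] := numbering_turn u circ; have [pos_inj pos_lt] := num.
have w0 : pos w != 0 by apply: contra_neq uw => w0; apply: pos_inj; rewrite u0.
have inU v : (v \in [set u; w]) = (pos v == 0) || (pos v == pos w).
  by rewrite !inE -u0 !(inj_eq pos_inj).
have [] : pos w = 1 \/ (pos w).+1 = #|T|; last 2 first.
- by move=> w1; left; apply: pos_inj; have := ts u; have := pos_lt w; lia.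
- by move=> w1; right; apply: pos_inj; have := ts w; have := pos_lt (s w); lia.
have [v1 v1E] : exists v, pos v = 1 by apply: (pos_surj num); have := pos_lt w; lia.
have [v2 v2E] : exists v, pos v = #|T|.-1 by apply: (pos_surj num); have := pos_lt w; lia.
have wn := pos_lt w.
have := inU u; have := inU w; have := inU v1; have := inU v2.
case/(is_arcP _ circ num ts): arcU => a [b [->|->]]; rewrite !inE u0 v1E v2E; lia.
Qed.

Lemma forward_or_backward s pos k m : circular s -> numbering pos -> m <= #|T| -> k.+1 < m ->
  (forall u w, k <= pos u -> pos w = (pos u).+1 -> pos w < m -> s u = w \/ s w = u) ->
  (forall u w, k <= pos u -> pos w = (pos u).+1 -> pos w < m -> s u = w) \/
  (forall u w, k <= pos u -> pos w = (pos u).+1 -> pos w < m -> s^-1%g u = w).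
Proof.
move=> circ num mn km adj; have [pos_inj pos_lt] := num.
have run (t : {perm T}) :
    (forall u w, k <= pos u -> pos w = (pos u).+1 -> pos w < m -> t u = w \/ t w = u) ->
    (forall u w, pos u = k -> pos w = k.+1 -> t u = w) ->
    forall u w, k <= pos u -> pos w = (pos u).+1 -> pos w < m -> t u = w.
  move=> adj' start u w ku; have [j uE] : exists j, pos u = k + j by exists (pos u - k); lia.
  elim: j u w {ku} uE => [|j IH] u w uE wE wm; first by apply: start; lia.
  have [x xE] : exists x, pos x = k + j by apply: (pos_surj num); lia.
  have xu : t x = u by apply: IH; lia.
  have ku : k <= pos u by lia.
  have [//|wu] := adj' u w ku wE wm.
  by have := congr1 pos (perm_inj (etrans xu (esym wu))); lia.
have [x xE] : exists x, pos x = k by apply: (pos_surj num); lia.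
have [y yE] : exists y, pos y = k.+1 by apply: (pos_surj num); lia.
have startE u w : pos u = k -> pos w = k.+1 -> u = x /\ w = y.
  by move=> uE wE; split; apply: pos_inj; lia.
have [xy|yx] : s x = y \/ s y = x by apply: adj; lia.
  by left; apply: run => // u w uE wE; have [-> ->] := startE u w uE wE.
right; apply: run => [u w ku uw wm|u w uE wE].
  by have [<-|<-] := adj u w ku uw wm; rewrite permK; [right|left].
by have [-> ->] := startE u w uE wE; rewrite -yx permK.
Qed.

Lemma forward_turns s pos m : circular s -> numbering pos -> 0 < m -> m <= #|T| ->
  (forall u w, pos w = (pos u).+1 -> pos w != m -> s u = w) -> turns s pos.
Proof.
move=> /forallP circ num m_gt0 mn fw; have [pos_inj pos_lt] := num.
have first_or_m v : pos (s v) != 0 -> pos (s v) != m -> (pos v).+1 = pos (s v).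
  move=> w0 wm.
  have [x xE] : exists x, pos x = (pos (s v)).-1.
    by apply: (pos_surj num); have := pos_lt (s v); lia.
  have sx : s x = s v by apply: fw => //; lia.
  by move: xE; rewrite (perm_inj sx); lia.
have end_m v : (pos v).+1 = m -> m < #|T| -> pos (s v) = m.
  move=> vm mn'; have [//|sm] := eqVneq (pos (s v)) m.
  have [s0|s0] := eqVneq (pos (s v)) 0; last by have := first_or_m v s0 sm; lia.
  have closed_s u : pos u < m -> pos (s u) < m.
    move=> um; have [uv|uv] := eqVneq (pos u) (pos v); first by rewrite (pos_inj u v uv) s0.
    have [w wE] : exists w, pos w = (pos u).+1 by apply: (pos_surj num); lia.
    by rewrite (fw u w); lia.
  have [z zE] : exists z, pos z = m by apply: (pos_surj num).
  have /iter_findex vz : fconnect s v z by move/forallP: (circ v); apply.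
  have : pos z < m by rewrite -vz; elim: (findex s v z) => [|k IH] /=; [lia|exact: closed_s].
  by rewrite zE ltnn.
move=> v; have vn := pos_lt v.
have [vl|vl] := eqVneq (pos v).+1 #|T|.
  have [->|s0] := eqVneq (pos (s v)) 0; first by rewrite orbT.
  have [sm|sm] := eqVneq (pos (s v)) m; last first.
    by have := first_or_m v s0 sm; have := pos_lt (s v); lia.
  have [x xE] : exists x, pos x = m.-1 by apply: (pos_surj num); lia.
  have mn' : m < #|T| by rewrite -sm.
  have xm : pos (s x) = m by apply: end_m => //; lia.
  by have := congr1 pos (perm_inj (pos_inj _ _ (etrans xm (esym sm)))); lia.
have [vm|vm] := eqVneq (pos v).+1 m; first by rewrite end_m ?vm ?eqxx //; lia.
have [w wE] : exists w, pos w = (pos v).+1 by apply: (pos_surj num); lia.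
by rewrite (fw v w) ?wE ?eqxx //.
Qed.

End Positions.

(** * Round orientations *)

Section Round.

Variables (T : finType) (e R : rel T).
Hypotheses (e_sym : symmetric e) (e_irr : irreflexive e).
Hypothesis orientedP : forall u v, u != v -> e u v = R u v || R v u.

Implicit Types (s : {perm T}) (pos : T -> nat).

Local Notation N := (closed_nbh e).

Definition cyclic_triple pos (u w v : T) :=
  [|| pos u < pos w < pos v, pos w < pos v < pos u | pos v < pos u < pos w].

(* For R u v meaning that the arc of u contains the start of the arc of v: u
   sees a run of vertices following it and is seen by a run preceding it. *)
Definition round pos := forall u w v,
  cyclic_triple pos u w v -> R u v -> R u w && R w v.

Lemma round_l pos u w v : round pos -> cyclic_triple pos u w v -> R u v -> R u w.
Proof. by move=> rnd cyc /(rnd _ _ _ cyc) /andP []. Qed.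

Lemma round_r pos u w v : round pos -> cyclic_triple pos u w v -> R u v -> R w v.
Proof. by move=> rnd cyc /(rnd _ _ _ cyc) /andP []. Qed.

Lemma round_rotation pos pos' k : numbering pos -> k < #|T| -> rotation k pos pos' ->
  round pos -> round pos'.
Proof.
move=> [_ pos_lt] kn rot rnd u w v cyc; apply: rnd.
move: cyc; rewrite /cyclic_triple; move: (rot u) (rot w) (rot v) (pos_lt u) (pos_lt w) (pos_lt v).
clear; lia.
Qed.

Lemma in_nbh u v : (u \in N v) = [|| u == v, R v u | R u v].
Proof. by rewrite inE; have [//|uv] := eqVneq u v; rewrite orientedP // eq_sym. Qed.

Lemma nbh_sym u v : (u \in N v) = (v \in N u).
Proof. by rewrite !inE eq_sym e_sym. Qed.

Lemma down_closed_itv pos (D : {set T}) : numbering pos ->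
  (forall u v, v \in D -> pos u < pos v -> u \in D) ->
  exists b, b <= #|T| /\ D = itv pos 0 b.
Proof.
move=> num down; have [->|/set0Pn [w0 w0D]] := eqVneq D set0.
  by exists 0; split=> //; apply/setP => v; rewrite !inE; lia.
case: (@arg_maxnP _ w0 (mem D) pos w0D) => w wD wmax.
exists (pos w).+1; split; first exact: num.2.
apply/setP => v; rewrite inE /= ltnS; apply/idP/idP => [/wmax //|].
rewrite leq_eqVlt => /orP [/eqP /num.1 -> //|]; exact: down.
Qed.

Lemma nbh_itv pos v : numbering pos -> round pos -> pos v = 0 ->
  exists b a, [/\ 0 < b <= #|T|, a <= #|T|,
    forall w, (w == v) || R v w = (pos w < b),
    forall w, (w != v) && R w v = (a <= pos w) & ~: N v = itv pos b a].
Proof.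
move=> num rnd v0; have [pos_inj pos_lt] := num.
have [|b [bn DE]] := @down_closed_itv pos [set w | (w == v) || R v w] num.
  move=> u w; rewrite !inE; have [//|uv] := eqVneq u v => /=.
  have u0 : 0 < pos u by rewrite lt0n -v0 (inj_eq pos_inj).
  have [->|wv] /= := eqVneq w v; first by rewrite v0.
  move=> vw uw; apply: (round_l rnd _ vw); by rewrite /cyclic_triple v0 u0 uw.
have [|a [an UE]] := @down_closed_itv pos [set w | ~~ ((w != v) && R w v)] num.
  move=> u w; rewrite !inE; have [//|uv] := eqVneq u v => /=.
  have u0 : 0 < pos u by rewrite lt0n -v0 (inj_eq pos_inj).
  have [->|wv] /= := eqVneq w v; first by rewrite v0.
  move=> + uw; apply: contraNN => Ruv.
  apply: (round_r rnd _ Ruv); by rewrite /cyclic_triple v0 u0 uw !orbT.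
have inD w : (w == v) || R v w = (pos w < b).
  by move/setP/(_ w): DE; rewrite !inE.
have inU w : (w != v) && R w v = (a <= pos w).
  by move/setP/(_ w): UE; rewrite !inE /= ltnNge => /negb_inj.
have b0 : 0 < b by rewrite -v0 -inD eqxx.
exists b, a; split=> //; first by rewrite b0.
apply/setP => w; rewrite inE in_nbh inE orbA inD.
have [->|wv] := eqVneq w v; first by rewrite v0 b0 (leqNgt b) b0.
by have := inU w; rewrite wv /= => ->; rewrite negb_or -leqNgt -ltnNge.
Qed.

Lemma round_is_arc s pos v : circular s -> numbering pos -> turns s pos -> round pos ->
  is_arc s (N v).
Proof.
move=> circ num ts rnd; have vn := num.2 v.
have [pos' [num' rot]] := numbering_rotation num vn.
have ts' := turns_rotation num vn ts rot.
have rnd' := round_rotation num vn rot rnd.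
have v0 : pos' v = 0 by have := rot v; clear; lia.
have [b [a [_ _ _ _ NE]]] := nbh_itv num' rnd' v0.
by apply/(is_arcP _ circ num' ts'); exists b, a; right; rewrite -NE setCK.
Qed.

Lemma round_touching s pos u v : numbering pos -> turns s pos -> round pos ->
  N u \subset N v -> N v != setT -> touching s (N u) (N v).
Proof.
move=> num ts rnd sub vT; have vn := num.2 v.
have [pos' [num' rot]] := numbering_rotation num vn.
have ts' := turns_rotation num vn ts rot.
have rnd' := round_rotation num vn rot rnd.
have v0 : pos' v = 0 by have := rot v; clear; lia.
have [b [a [/andP [b0 bn] an inD inU NE]]] := nbh_itv num' rnd' v0.
have notN w : (w \notin N v) = (b <= pos' w < a) by move/setP/(_ w): NE; rewrite !inE.
have ab : b < a.
  rewrite ltnNge; apply: contraNN vT => ba; rewrite eqEsubset subsetT; apply/subsetP => w _.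
  by rewrite -[_ \in _]negbK notN; clear -ba; lia.
have [x xE] : exists x, pos' x = b.-1 by apply: (pos_surj num'); clear -b0 bn; lia.
have sx : s x \notin N v.
  by rewrite notN; have := ts' x; rewrite xE; clear -ab b0 an; lia.
have uN : u \in N v by apply: (subsetP sub); rewrite inE eqxx.
have [uv|uv] := eqVneq u v.
  apply/existsP; exists x; rewrite sx andbT uv.
  by rewrite -[_ \in _]negbK notN xE; clear -b0; lia.
move: uN; rewrite in_nbh (negPf uv) /= => /orP [vu|uv'].
  apply/existsP; exists x; rewrite sx andbT in_nbh.
  have [//|xu] /= := eqVneq x u; apply/orP; left.
  have ub : pos' u < b by rewrite -inD vu orbT.
  have u0 : 0 < pos' u by rewrite lt0n -v0 (inj_eq num'.1).
  have ux : pos' u < pos' x.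
    by rewrite ltn_neqAle (inj_eq num'.1) eq_sym xu /= xE; clear -ub b0; lia.
  have vx : R v x.
    have := inD x; rewrite xE prednK // leqnn; case: eqP => // xv.
    by move: ux; rewrite xv v0.
  apply: (round_r rnd' _ vx); by rewrite /cyclic_triple v0 u0 ux.
have au : a <= pos' u by rewrite -inU uv uv'.
have un := num'.2 u.
have [y yE] : exists y, pos' y = a by apply: (pos_surj num'); apply: leq_ltn_trans un.
apply/existsP; exists y; apply/andP; split; last first.
  apply/orP; right; rewrite notN; have := ts' (s^-1%g y); rewrite permKV yE.
  by have := num'.2 (s^-1%g y); clear -ab b0 ; lia.
rewrite in_nbh; have [//|yu] /= := eqVneq y u; apply/orP; right.
have yu' : pos' y < pos' u by rewrite ltn_neqAle (inj_eq num'.1) yu yE.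
have /andP [_ yv] : (y != v) && R y v by rewrite inU yE.
apply: (round_l rnd' _ yv); by rewrite /cyclic_triple v0; clear -ab b0 yE yu'; lia.
Qed.

Lemma round_tight_ordering s pos : circular s -> numbering pos -> turns s pos -> round pos ->
  tight_arc_ordering (nbh_hypergraph e) s.
Proof.
move=> circ num ts rnd; apply/andP; split.
  apply/andP; split=> //; apply/forall_inP => _ /imsetP [v _ ->].
  exact: round_is_arc circ num ts rnd.
apply: touching_tight => // _ _ /imsetP [u _ ->] /imsetP [v _ ->] _.
exact: round_touching num ts rnd.
Qed.

Lemma cliques_bipartite (P : pred T) :
  (forall x y, P x = P y -> x \in N y) -> bipartite (compl_graph e).
Proof.
move=> cl; exists P => u v /andP [uv nuv]; apply: contraNneq nuv => /esym Puv.
by have := cl v u Puv; rewrite inE eq_sym (negPf uv).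
Qed.

Lemma universal_bipartite pos v : numbering pos -> round pos ->
  (forall u, u \in N v) -> bipartite (compl_graph e).
Proof.
move=> num rnd univ; apply: (@cliques_bipartite (fun u => (u == v) || R v u)) => x y.
have [->|xv] /= := eqVneq x v; first by rewrite nbh_sym univ.
have [->|yv] /= := eqVneq y v; first by rewrite univ.
have := univ x; have := univ y; rewrite !in_nbh (negPf xv) (negPf yv) /= => yN xN.
have [//|xy] /= := eqVneq x y => sameR.
have nq a b : a != b -> pos a != pos b by rewrite (inj_eq num.1).
have := nq _ _ xy; have := nq _ _ xv; have := nq _ _ yv => yv' xv' xy'.
have [vx|vx] := boolP (R v x).
  rewrite vx in sameR; have : cyclic_triple pos v x y || cyclic_triple pos v y x.
    by rewrite /cyclic_triple; clear -xv' yv' xy'; lia.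
  by case/orP => /rnd; [move/(_ (esym sameR))|move/(_ vx)] => /andP [_ ->]; rewrite ?orbT.
rewrite (negPf vx) in sameR xN; rewrite -sameR in yN.
have : cyclic_triple pos x y v || cyclic_triple pos y x v.
  by rewrite /cyclic_triple; clear -xv' yv' xy'; lia.
by case/orP => /rnd; [move/(_ xN)|move/(_ yN)] => /andP [->]; rewrite ?orbT.
Qed.

End Round.

Section Crossing.

Variables (T : finType) (e R : rel T).
Hypotheses (e_sym : symmetric e) (e_irr : irreflexive e).
Hypothesis orientedP : forall u v, u != v -> e u v = R u v || R v u.
Hypothesis e_conn : connected_graph e.
Hypothesis e_twin_free : twin_free e.
Hypothesis not_universal : forall v, exists u, u \notin closed_nbh e v.

Local Notation N := (closed_nbh e).

Let inN := in_nbh orientedP.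
Let symN := nbh_sym e_sym.

Definition uncrossed pos m := forall v u1 u2 w1 w2,
  pos u1 < m -> pos u2 < m -> m <= pos w1 -> m <= pos w2 ->
  u1 \in N v -> u2 \notin N v -> w1 \in N v -> w2 \in N v.

(* The four alternatives say that u, u', v', v come in this cyclic order, with
   u' = u and v' = v allowed. *)
Lemma round_sub pos u v u' v' : injective pos -> round R pos -> R u v ->
  [|| (pos u <= pos u') && (pos u' < pos v' <= pos v),
      (pos v < pos u <= pos u') && (pos u' < pos v'),
      (pos v < pos u) && (pos u' < pos v' <= pos v) |
      (pos v < pos u <= pos u') && (pos v' <= pos v)] -> R u' v'.
Proof.
move=> pos_inj rnd uv ord.
have u'v : R u' v.
  have [->//|] := eqVneq u' u; rewrite -(inj_eq pos_inj) => uu.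
  by apply: (round_r rnd _ uv); rewrite /cyclic_triple; clear -ord uu; lia.
have [->//|] := eqVneq v' v; rewrite -(inj_eq pos_inj) => vv.
by apply: (round_l rnd _ u'v); rewrite /cyclic_triple; clear -ord vv; lia.
Qed.

Lemma uncrossed_clique_forward pos m x y i j : numbering pos -> round R pos -> uncrossed pos m ->
  pos x < m -> pos y < m -> y \notin N x ->
  pos i < m -> m <= pos j -> R i j ->
  forall p q, m <= pos p -> m <= pos q -> q \in N p.
Proof.
move=> num rnd unc xm ym xy im mj ij; have [pos_inj pos_lt] := num.
have jn := pos_lt j.
have xy0 : x != y by apply: contraNneq xy => ->; rewrite inE eqxx.
have [z0 z0E] : exists z, pos z = 0 by apply: (pos_surj num); clear -jn; lia.
have [w wE] : exists z, pos z = m.-1 by apply: (pos_surj num); clear -jn im mj; lia.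
have [b1 b1E] : exists z, pos z = m by apply: (pos_surj num); clear -jn mj; lia.
have [b2 b2E] : exists z, pos z = #|T|.-1 by apply: (pos_surj num); clear -jn; lia.
have wb1 : R w b1 by apply: (round_sub pos_inj rnd ij); clear -im mj wE b1E; lia.
have neq a b : (a == b) = (pos a == pos b) by rewrite (inj_eq pos_inj).
rewrite neq in xy0.
have z0w : ~~ R z0 w.
  apply: contraNN xy => z0w; rewrite inN; case: (ltngtP (pos x) (pos y)) => xy'.
  - by rewrite (round_sub pos_inj rnd z0w (u' := x) (v' := y)) ?orbT //; clear -xy' ym wE z0E; lia.
  - by rewrite (round_sub pos_inj rnd z0w (u' := y) (v' := x)) ?orbT //; clear -xy' xm wE z0E; lia.
  - by rewrite xy' eqxx in xy0.
have z0P : (z0 != w) && (pos z0 < m) && ~~ R z0 w.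
  by rewrite z0w neq; clear -xy0 xm ym wE z0E; lia.
case: (@arg_maxnP _ z0 (fun z => (z != w) && (pos z < m) && ~~ R z w) pos z0P) => z.
move=> /andP [/andP [zw zm] nRzw] zmax; rewrite neq in zw.
have Rw u : u != w -> pos z < pos u < m -> R u w.
  move=> uw /andP [zu um]; have := zmax u; rewrite uw um /=.
  by case: (R u w) => // /(_ isT); rewrite /= leqNgt zu.
have wz : w \notin N z.
  rewrite inN negb_or (negPf nRzw) neq eq_sym zw /=.
  have [u] := not_universal w; apply: contraNN => Rwz.
  rewrite inN; have [//|uw] /= := eqVneq u w; have uw' := uw; rewrite neq in uw'.
  have [uzm|uzm] := boolP (pos z < pos u < m); first by rewrite Rw ?orbT.
  by rewrite (round_sub pos_inj rnd Rwz (u' := w) (v' := u)) //; clear -uzm zm wE zw uw'; lia.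
have wN : w \in N w by rewrite inE eqxx.
have b2N : b2 \in N w.
  apply: (unc w w z b1 b2) => //; rewrite ?wE ?b1E ?b2E //; try (clear -im jn mj; lia).
    by rewrite symN.
  by rewrite inN wb1 orbT.
have Rwb2 : R w b2.
  move: b2N; rewrite inN neq b2E wE => /or3P [|//|b2w]; first by clear -jn mj im; lia.
  case/negP: z0w; apply: (round_sub pos_inj rnd b2w).
  by clear -xy0 xm ym z0E wE b2E mj jn; lia.
move=> p q pm qm; rewrite inN; have [//|] /= := eqVneq q p; rewrite neq => pq.
have pn := pos_lt p; have qn := pos_lt q.
have [pq'|pq'] := leqP (pos p) (pos q).
  by rewrite (round_sub pos_inj rnd Rwb2 (u' := p) (v' := q)) //; clear -pq pq' pm qn wE b2E; lia.
rewrite (round_sub pos_inj rnd Rwb2 (u' := q) (v' := p)) ?orbT //.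
by clear -pq pq' qm pn wE b2E; lia.
Qed.

Lemma uncrossed_rotation pos pos' m : numbering pos -> m < #|T| -> rotation m pos pos' ->
  uncrossed pos m -> uncrossed pos' (#|T| - m).
Proof.
move=> [_ pos_lt] mn rot unc v u1 u2 w1 w2 u1m u2m w1m w2m u1N u2N w1N.
have low x : pos' x < #|T| - m -> m <= pos x by have := rot x; have := pos_lt x; clear; lia.
have high x : #|T| - m <= pos' x -> pos x < m by have := rot x; have := pos_lt x; clear; lia.
apply: contraNT u2N => w2N.
by apply: (unc v w1 w2 u1 u2) => //; [exact: high|exact: high|exact: low|exact: low].
Qed.

Lemma uncrossed_clique pos m x y p q : numbering pos -> round R pos -> uncrossed pos m ->
  pos x < m -> pos y < m -> y \notin N x ->
  m <= pos p -> m <= pos q -> q \in N p.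
Proof.
move=> num rnd unc xm ym xy pm qm; apply: contraNT (xy) => pq.
have [u [v [um vm uv]]] : exists u v, [/\ pos u < m, m <= pos v & e u v].
  have /connectP [c] := e_conn x p.
  elim: c x {xy ym} xm => [|z c IH] x xm /=; first by move=> _ px; move: pm; rewrite px leqNgt xm.
  case/andP => xz zc pl; have [zm|zm] := ltnP (pos z) m; last by exists x, z.
  exact: IH zc pl.
have uv0 : u != v by apply: contraTneq uv => ->; rewrite e_irr.
move: uv; rewrite orientedP // => /orP [uv|vu].
  by have /negP [] := pq; apply: (uncrossed_clique_forward num rnd unc xm ym xy um vm uv).
have mn : m < #|T| by apply: leq_ltn_trans (num.2 p).
have [pos' [num' rot]] := numbering_rotation num mn.
have rnd' := round_rotation num mn rot rnd.
have low z : m <= pos z -> pos' z < #|T| - m by have := rot z; have := num.2 z; clear; lia.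
have high z : pos z < m -> #|T| - m <= pos' z by have := rot z; have := num.2 z; clear; lia.
exact: (uncrossed_clique_forward num' rnd' (uncrossed_rotation num mn rot unc)
  (low _ pm) (low _ qm) pq (low _ vm) (high _ um) vu (high _ xm) (high _ ym)).
Qed.

Lemma uncrossed_bipartite pos m x y : numbering pos -> round R pos -> uncrossed pos m ->
  m.+1 < #|T| -> pos x < m -> pos y < m -> y \notin N x -> bipartite (compl_graph e).
Proof.
move=> num rnd unc mn xm ym xy; have [pos_inj pos_lt] := num.
have clB p q := uncrossed_clique num rnd unc xm ym xy (p := p) (q := q).
have xy0 : x != y by apply: contraNneq xy => ->; rewrite inE eqxx.
have [z0 z0E] : exists z, pos z = 0 by apply: (pos_surj num); clear -mn; lia.
have [l lE] : exists z, pos z = m.-1 by apply: (pos_surj num); clear -mn; lia.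
have [b1 b1E] : exists z, pos z = m by apply: (pos_surj num); clear -mn; lia.
have [b2 b2E] : exists z, pos z = #|T|.-1 by apply: (pos_surj num); clear -mn; lia.
have eqp a b : (a == b) = (pos a == pos b) by rewrite (inj_eq pos_inj).
rewrite eqp in xy0.
have b1m : m <= pos b1 by rewrite b1E.
have b2m : m <= pos b2 by rewrite b2E; clear -mn; lia.
have [w wP] : exists w, (b1 \in N w) != (b2 \in N w).
  have b12 : b1 != b2 by rewrite eqp b1E b2E; clear -mn; lia.
  apply/existsP; apply: contraNT (e_twin_free b12) => /existsPn same.
  apply/eqP/setP => w.
  by have := same w; rewrite negbK => /eqP; rewrite symN => ->; rewrite symN.
have wm : pos w < m.
  by rewrite ltnNge; apply: contraNN wP => mw; rewrite !clB.
have wN : w \in N w by rewrite inE eqxx.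
have allA u : pos u < m -> u \in N w.
  move=> um; apply: contraNT wP => uN.
  apply/eqP; apply/idP/idP; [exact: (unc w w u b1 b2)|exact: (unc w w u b2 b1)].
have someB : exists b, [/\ m <= pos b, b \in N w & exists b', m <= pos b' /\ b' \notin N w].
  have [b1N|b1N] := boolP (b1 \in N w); move: wP; rewrite ?(negPf b1N) ?b1N.
    by case: (boolP (b2 \in N w)) => // b2N _; exists b1; split=> //; exists b2.
  by case: (boolP (b2 \in N w)) => // b2N _; exists b2; split=> //; exists b1.
have [b [bm bN [b' [b'm b'N]]]] := someB.
have bn := pos_lt b; have b'n := pos_lt b'.
have noR u v : pos u <= pos w -> m <= pos v -> ~~ (R w u && (pos u < pos w)).
  move=> uw vm; apply: contraNN b'N => /andP [wu uw'].
  rewrite inN (round_sub pos_inj rnd wu (u' := w) (v' := b')) ?orbT //.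
  by clear -uw' wm b'm; lia.
have z0l : ~~ R z0 l.
  apply: contraNN xy => z0l; rewrite inN; case: (ltngtP (pos x) (pos y)) => xy'.
  + by rewrite (round_sub pos_inj rnd z0l (u' := x) (v' := y)) ?orbT //; clear -xy' ym lE z0E; lia.
  + by rewrite (round_sub pos_inj rnd z0l (u' := y) (v' := x)) ?orbT //; clear -xy' xm lE z0E; lia.
  + by rewrite xy' eqxx in xy0.
move: bN; rewrite inN eqp => /or3P [|wb|bw].
- by clear -wm bm; lia.
- have lP : (l != z0) && (pos l < m) && ~~ R z0 l.
    by rewrite z0l eqp; clear -xy0 xm ym lE z0E; lia.
  case: (@arg_minnP _ l (fun z => (z != z0) && (pos z < m) && ~~ R z0 z) pos lP) => z.
  move=> /andP [/andP [zz0 zm] nRz] zmin; have zz0' := zz0; rewrite eqp in zz0'.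
  have Rz u : u != z0 -> pos u < pos z -> R z0 u.
    move=> uz0 uz; have := zmin u; rewrite uz0 (ltn_trans uz zm) /=.
    by case: (R z0 u) => // /(_ isT); rewrite leqNgt uz.
  have wz : pos w < pos z.
    rewrite ltnNge; apply: contraNN nRz => zw.
    have z0wN := allA z0; rewrite z0E inN eqp in z0wN.
    have /or3P [|wz0|z0w] := z0wN (leq_ltn_trans (leq0n _) xm).
    + by clear -zz0' z0E zw; lia.
    + have := noR z0 b; rewrite wz0 z0E leq0n bm /= => /(_ isT isT).
      by clear -zz0' z0E zw; lia.
    + by apply: (round_sub pos_inj rnd z0w); clear -zz0' z0E zw; lia.
  have zb1 : R z b1 by apply: (round_sub pos_inj rnd wb); clear -wz zm b1E bm; lia.
  have z0N : z0 \notin N z.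
    rewrite inN eqp eq_sym (negPf zz0') (negPf nRz) orbF /=.
    have [u] := not_universal z0; apply: contraNN => Rzz0.
    rewrite inN; have [//|uz0] /= := eqVneq u z0.
    have [uz|uz] := ltnP (pos u) (pos z); first by rewrite Rz.
    by rewrite (round_sub pos_inj rnd Rzz0 (u' := u) (v' := z0)) ?orbT //; clear -uz zz0' z0E; lia.
  have b2N : b2 \in N z.
    apply: (unc z z z0 b1 b2) => //; first by rewrite z0E; clear -xm; lia.
    + by rewrite inE eqxx.
    + by rewrite inN zb1 orbT.
  have zb2 : R z b2.
    move: b2N; rewrite inN eqp => /or3P [|//|b2z]; first by clear -zm b2m; lia.
    case/negP: nRz; apply: (round_sub pos_inj rnd b2z).
    by clear -zz0' z0E zm b2m; lia.
  (* z0 sees everything before z, and z sees everything after it. *)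
  apply: (@cliques_bipartite _ _ (fun u => pos u < pos z)) => u v same.
  rewrite inN; have [//|uv] /= := eqVneq u v; rewrite eqp in uv.
  have un := pos_lt u; have vn := pos_lt v.
  wlog uv' : u v same uv un vn / pos u < pos v.
    move=> H; case: (ltngtP (pos u) (pos v)) => uv'; first exact: H.
      by rewrite orbC; apply: H => //; rewrite eq_sym.
    by rewrite uv' eqxx in uv.
  have [vz|vz] := ltnP (pos v) (pos z).
    have vz0 : v != z0 by rewrite eqp z0E; clear -uv'; lia.
    rewrite (round_sub pos_inj rnd (Rz v vz0 vz) (u' := u) (v' := v)) ?orbT //.
    by clear -uv' z0E; lia.
  rewrite (round_sub pos_inj rnd zb2 (u' := u) (v' := v)) ?orbT //.
  by clear -uv' vz same vn b2E; lia.
- have z0P : (z0 != l) && (pos z0 < m) && ~~ R z0 l.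
    by rewrite z0l eqp; clear -xy0 xm ym lE z0E; lia.
  case: (@arg_maxnP _ z0 (fun z => (z != l) && (pos z < m) && ~~ R z l) pos z0P) => z.
  move=> /andP [/andP [zl zm] nRz] zmax; have zl' := zl; rewrite eqp in zl'.
  have Rl u : u != l -> pos z < pos u < m -> R u l.
    move=> ul /andP [zu um]; have := zmax u; rewrite ul um /=.
    by case: (R u l) => // /(_ isT); rewrite /= leqNgt zu.
  have lm : pos l < m by rewrite lE; clear -xm; lia.
  have zw : pos z < pos w.
    rewrite ltnNge; apply: contraNN nRz => wz.
    have := allA l lm; rewrite inN eqp => /or3P [|wl|lw].
    + by clear -zl' lE zm wz; lia.
    + by apply: (round_sub pos_inj rnd wl); clear -zl' lE zm wz; lia.
    + case/negP: b'N; rewrite inN (round_sub pos_inj rnd lw (u' := b') (v' := w)) ?orbT //.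
      by clear -zl' lE zm wz b'm; lia.
  have b2z : R b2 z by apply: (round_sub pos_inj rnd bw); clear -zw wm b2E bm bn; lia.
  have lN : l \notin N z.
    rewrite inN eqp eq_sym (negPf zl') (negPf nRz) /=.
    have [u] := not_universal l; apply: contraNN => Rlz.
    rewrite inN; have [//|ul] /= := eqVneq u l; have ul' := ul; rewrite eqp in ul'.
    have [uz|uz] := boolP (pos z < pos u < m); first by rewrite Rl ?orbT.
    rewrite (round_sub pos_inj rnd Rlz (u' := l) (v' := u)) //.
    by clear -uz zl' zm lE ul'; lia.
  have b1N : b1 \in N z.
    apply: (unc z z l b2 b1) => //; first by rewrite inE eqxx.
    by rewrite inN b2z !orbT.
  have b1z : R b1 z.
    move: b1N; rewrite inN eqp => /or3P [|zb1|//]; first by clear -zm b1m; lia.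
    case/negP: nRz; apply: (round_sub pos_inj rnd zb1).
    by clear -zl' lE zm b1E; lia.
  apply: (@cliques_bipartite _ _ (fun u => pos z < pos u < m)) => u v same.
  rewrite inN; have [//|uv] /= := eqVneq u v; rewrite eqp in uv.
  have un := pos_lt u; have vn := pos_lt v.
  have [uzm|uzm] := boolP (pos z < pos u < m).
    rewrite uzm in same; have := esym same => vzm.
    case: (ltngtP (pos u) (pos v)) => uv'; last by rewrite uv' eqxx in uv.
      have ul : u != l by rewrite eqp; clear -uv' vzm lE; lia.
      rewrite (round_sub pos_inj rnd (Rl u ul uzm) (u' := u) (v' := v)) ?orbT //.
      by clear -uv' vzm lE; lia.
    have vl : v != l by rewrite eqp; clear -uv' uzm lE; lia.
    rewrite (round_sub pos_inj rnd (Rl v vl vzm) (u' := v) (v' := u)) ?orbT //.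
    by clear -uv' uzm lE; lia.
  rewrite (negPf uzm) in same; have vzm : ~~ (pos z < pos v < m) by rewrite -same.
  have : [|| (pos z < pos b1 <= pos u) && (pos u < pos v),
      (pos z < pos b1) && (pos u < pos v <= pos z) |
      (pos z < pos b1 <= pos u) && (pos v <= pos z)] ||
     [|| (pos z < pos b1 <= pos v) && (pos v < pos u),
      (pos z < pos b1) && (pos v < pos u <= pos z) |
      (pos z < pos b1 <= pos v) && (pos u <= pos z)].
    by clear -uzm vzm b1E zm uv; lia.
  case/orP => ord.
    by rewrite (round_sub pos_inj rnd b1z (u' := u) (v' := v)) ?orbT // ord orbT.
  by rewrite (round_sub pos_inj rnd b1z (u' := v) (v' := u)) ?orbT // ord orbT.
Qed.

Lemma round_crossing pos m : numbering pos -> round R pos -> 1 < m -> m.+1 < #|T| ->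
  ~ bipartite (compl_graph e) ->
  exists v u1 u2 w1 w2, [/\ pos u1 < m, pos u2 < m, m <= pos w1 & m <= pos w2] /\
    [/\ u1 \in N v, u2 \notin N v, w1 \in N v & w2 \notin N v].
Proof.
move=> num rnd m1 mn nbip.
have [/existsP [v]|/existsPn nsplit] := boolP [exists v,
  [exists u1, exists u2, exists w1, exists w2,
    [&& pos u1 < m, pos u2 < m, m <= pos w1, m <= pos w2,
     u1 \in N v, u2 \notin N v, w1 \in N v & w2 \notin N v]]].
  move=> /existsP [u1 /existsP [u2 /existsP [w1 /existsP [w2 /and4P [? ? ? /and5P [? ? ? ? ?]]]]]].
  by exists v, u1, u2, w1, w2.
have unc : uncrossed pos m.
  move=> v u1 u2 w1 w2 u1m u2m w1m w2m u1N u2N w1N; apply: contraT => w2N.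
  have /negP [] := nsplit v; apply/existsP; exists u1; apply/existsP; exists u2.
  apply/existsP; exists w1; apply/existsP; exists w2.
  by apply/and4P; split=> //; apply/and5P; split.
case: nbip.
have [/existsP [x /existsP [y /and3P [xm ym xy]]]|clA] :=
  boolP [exists x, exists y, [&& pos x < m, pos y < m & y \notin N x]].
  exact: uncrossed_bipartite num rnd unc mn xm ym xy.
have mn' : m < #|T| by exact: ltnW.
have [pos' [num' rot]] := numbering_rotation num mn'.
have rnd' := round_rotation num mn' rot rnd.
have unc' := uncrossed_rotation num mn' rot unc.
have low z : m <= pos z -> pos' z < #|T| - m by have := rot z; have := num.2 z; clear; lia.
have [/existsP [x /existsP [y /and3P [xm ym xy]]]|clB] :=
  boolP [exists x, exists y, [&& m <= pos x, m <= pos y & y \notin N x]].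
  apply: (uncrossed_bipartite num' rnd' unc' _ (low _ xm) (low _ ym) xy).
  by clear -m1 mn; lia.
apply: (@cliques_bipartite _ _ (fun u => pos u < m)) => x y.
have [ym|ym] := ltnP (pos y) m => xm.
  apply: contraNT clA => xy; apply/existsP; exists y; apply/existsP; exists x.
  by rewrite xm ym xy.
apply: contraNT clB => xy; apply/existsP; exists y; apply/existsP; exists x.
by rewrite ym leqNgt xm xy.
Qed.

End Crossing.

(** * Non-bipartite complement *)

Section Uniqueness.

Variable T : finType.
Implicit Types (s : {perm T}) (pos : T -> nat) (A B : {set T}).

Lemma circularV s : circular s -> circular s^-1%g.
Proof.
move=> /forallP circ; apply/forallP => x; apply/forallP => y.
have yx : fconnect s y x by move/forallP: (circ y); apply.
suff -> : y = iter (findex s y x) s^-1%g x by exact: fconnect_iter.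
rewrite -{2}(iter_findex yx); elim: (findex s y x) => // k IH.
by rewrite iterSr [iter k.+1 s y]iterS permK.
Qed.

Lemma card_itv pos a b : numbering pos -> b <= #|T| -> #|itv pos a b| = b - a.
Proof.
move=> num; elim: b => [|b IH] bn.
  by apply/eqP; rewrite cards_eq0; apply/eqP/setP => v; rewrite !inE andbF.
have [ba|ab] := ltnP b a.
  rewrite (eqP ba); apply/eqP; rewrite cards_eq0; apply/eqP/setP => v.
  by rewrite !inE; clear -ba; lia.
have [v vE] := pos_surj num bn.
have -> : itv pos a b.+1 = v |: itv pos a b.
  apply/setP => x; rewrite !inE -(inj_eq num.1) vE; clear -ab; lia.
by rewrite cardsU1 inE vE ltnn andbF IH ?(ltnW bn) // subSn.
Qed.

Lemma itv_rotation pos pos' k a b : rotation k pos pos' -> k <= a -> b <= #|T| ->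
  itv pos' (a - k) (b - k) = itv pos a b.
Proof.
by move=> rot ka bn; apply/setP => v; rewrite !inE; have := rot v; clear -ka bn; lia.
Qed.

Lemma arc_chord s pos A : circular s -> numbering pos -> turns s pos -> is_arc s A ->
  A != set0 -> A != setT ->
  exists a b : 'I_#|T|, a < b /\ (A = itv pos a b \/ A = ~: itv pos a b).
Proof.
move=> circ num ts arcA A0 AT.
have main B : B != set0 -> B != setT -> (exists a b, B = itv pos a b) ->
    exists a b : 'I_#|T|, a < b /\ (B = itv pos a b \/ B = ~: itv pos a b).
  move=> B0 BT [a [b BE]]; have /set0Pn [z zB] := B0; rewrite BE inE in zB.
  have zn := num.2 z; have an : a < #|T| by clear -zn zB; lia.
  have [bn|bn] := ltnP b #|T|.
    by exists (Ordinal an), (Ordinal bn); split; [case/andP: zB; exact: leq_ltn_trans|left].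
  have a0 : 0 < a.
    rewrite lt0n; apply: contraNneq BT => a0; rewrite eqEsubset subsetT BE a0.
    by apply/subsetP => v _; rewrite inE (leq_trans (num.2 v)).
  have n0 : 0 < #|T| by clear -zn; lia.
  exists (Ordinal n0), (Ordinal an); split=> //; right; rewrite BE; apply/setP => v.
  by rewrite !inE /=; have := num.2 v; clear -bn; lia.
move/(is_arcP _ circ num ts): arcA => [a [b [AE|AE]]].
  by apply: main => //; exists a, b.
have [|||i [j [ij E]]] := main (~: A).
- by rewrite -(inj_eq (@setC_inj T)) setCK setC0.
- by rewrite -(inj_eq (@setC_inj T)) setCK setCT.
- by exists a, b; rewrite AE setCK.
by exists i, j; split=> //; case: E => E; [right|left]; rewrite -[A]setCK E ?setCK.
Qed.

Lemma gap n (S : {set 'I_n}) (x i0 : 'I_n) :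
  x \notin S -> i0 \in S -> i0 < x ->
  exists a : 'I_n, exists b, [/\ a \in S, a < x < b, b <= n,
     b = n \/ (exists2 j : 'I_n, j \in S & b = j) &
     forall i : 'I_n, i \in S -> i <= a \/ b <= i].
Proof.
move=> xS i0S i0x.
case: (@arg_maxnP _ i0 (fun i : 'I_n => (i \in S) && (i < x)) (fun i => i : nat)).
  by rewrite i0S.
move=> a /andP [aS ax] amax.
have split_x (i : 'I_n) : i \in S -> i < x \/ x < i.
  by move=> iS; case: (ltngtP i x) => [|| ix]; [left|right|case/negP: xS; rewrite -(val_inj ix)].
have [/existsP [j0 j0P]|/existsPn none] := boolP [exists j : 'I_n, (j \in S) && (x < j)].
  case: (@arg_minnP _ j0 (fun i : 'I_n => (i \in S) && (x < i)) (fun i => i : nat) j0P).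
  move=> j /andP [jS xj] jmin; exists a, j; split=> //; first by rewrite ax.
  - exact: ltnW.
  - by right; exists j.
  - move=> i iS; have [ix|xi] := split_x i iS; first by left; apply: amax; rewrite iS.
    by right; apply: jmin; rewrite iS.
exists a, n; split=> //; first by rewrite ax /=.
  by left.
move=> i iS; left; apply: amax; rewrite iS; have [//|xi] := split_x i iS.
by have := none i; rewrite iS xi.
Qed.

Section NonBipartite.

Variables (e R : rel T).
Hypotheses (e_sym : symmetric e) (e_irr : irreflexive e).
Hypothesis orientedP : forall u v, u != v -> e u v = R u v || R v u.
Hypothesis e_conn : connected_graph e.
Hypothesis e_twin_free : twin_free e.
Hypothesis nbip : ~ bipartite (compl_graph e).

Local Notation N := (closed_nbh e).

Lemma nonneighbor pos v : numbering pos -> round R pos -> exists u, u \notin N v.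
Proof.
move=> num rnd; apply/existsP; apply: contra_notT nbip => /existsPn univ.
by apply: (universal_bipartite e_sym orientedP (v := v) num rnd) => u; rewrite -[_ \in _]negbK univ.
Qed.

Lemma neighbor v : 1 < #|T| -> exists2 u, u != v & u \in N v.
Proof.
move=> n1; have [w wv] : exists w, w != v.
  apply/existsP; apply: contraTT n1 => /existsPn eqv; rewrite -leqNgt.
  by apply/fintype_le1P => x y; rewrite (eqP (negbNE (eqv x))) (eqP (negbNE (eqv y))).
have /connectP [[|u c] /=] := e_conn v w; first by move=> _ wv'; rewrite wv' eqxx in wv.
case/andP => vu _ _; exists u; last by rewrite inE vu orbT.
by apply: contraTneq vu => ->; rewrite e_irr.
Qed.

Lemma proper_nonneighborhood pos : numbering pos -> exists v, 1 < #|~: N v| < #|T|.-1.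
Proof.
move=> num.
have n1 : 1 < #|T|.
  rewrite ltnNge; apply/negP => n1; apply: nbip; exists (fun=> true) => u v /andP [uv _].
  by case/eqP: uv; apply: esym; exact: (fintype_le1P n1 u v).
have [/existsP //|/existsPn small] := boolP [exists v, 1 < #|~: N v| < #|T|.-1].
have deg1 v : #|~: N v| <= 1.
  rewrite leqNgt; apply: contraNN (small v) => -> /=.
  have [u uv uN] := neighbor v n1.
  have : #|[set u; v]| <= #|N v|.
    by apply/subset_leq_card/subsetP => x /set2P [->|->] //; rewrite inE eqxx.
  rewrite cards2 uv => N2; rewrite -(cardsC (N v)); case: #|N v| N2 => [|[|k]] // _.
  by rewrite addSn /= addSn ltnS leq_addl.
case: nbip.
have cE u v : compl_graph e u v = (v \in ~: N u).
  by rewrite inE inE negb_or eq_sym.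
have cS u v : compl_graph e u v = compl_graph e v u by rewrite /compl_graph /= eq_sym e_sym.
exists (fun u => [exists v, compl_graph e u v && (pos u < pos v)]) => u v.
wlog uv : u v / pos u < pos v.
  move=> H; case: (ltngtP (pos u) (pos v)) => [uv|vu|/num.1 -> /andP []]; first exact: H.
    by rewrite cS eq_sym; apply: H.
  by rewrite eqxx.
move=> cuv; have -> : [exists w, compl_graph e u w && (pos u < pos w)].
  by apply/existsP; exists v; rewrite cuv.
suff /negPf -> : ~~ [exists w, compl_graph e v w && (pos v < pos w)] by [].
apply/existsPn => w; apply/negP => /andP [vw vw'].
have uw : u = w by apply: (card_le1_eqP (deg1 v)); rewrite -cE // cS.
by move: vw'; rewrite -uw ltnNge ltnW.
Qed.

End NonBipartite.

End Uniqueness.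

Section NonBipartiteUniqueness.

Variable T : finType.
Implicit Types (s : {perm T}) (pos : T -> nat) (A B : {set T}).

Variables (e R : rel T).
Hypotheses (e_sym : symmetric e) (e_irr : irreflexive e).
Hypothesis orientedP : forall u v, u != v -> e u v = R u v || R v u.
Hypothesis e_conn : connected_graph e.
Hypothesis e_twin_free : twin_free e.
Hypothesis nbip : ~ bipartite (compl_graph e).

Local Notation N := (closed_nbh e).

Lemma crossing_of_split pos (A : {set T}) a b c d u1 u2 w1 w2 :
  a < b -> A = itv pos a b -> c < d -> d <= #|T| -> (forall v, pos v < #|T|) ->
  c <= pos u1 < d -> c <= pos u2 < d -> ~~ (c <= pos w1 < d) -> ~~ (c <= pos w2 < d) ->
  u1 \in A -> u2 \notin A -> w1 \in A -> w2 \notin A ->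
  (c < a < d) && crossing c (if d < #|T| then d else 0) a b ||
  (c < b < d) && crossing c (if d < #|T| then d else 0) b a.
Proof.
move=> ab -> cd dn pos_lt; rewrite !inE => u1c u2c w1c w2c u1A u2A w1A w2A.
have := pos_lt u1; have := pos_lt u2; have := pos_lt w1; have := pos_lt w2.
move: (pos u1) (pos u2) (pos w1) (pos w2) u1c u2c w1c w2c u1A u2A w1A w2A.
move=> i1 i2 j1 j2 *.
rewrite /crossing; case: (ltnP d #|T|) => dn'.
  rewrite !(minn_idPl (ltnW cd)) !(maxn_idPr (ltnW cd)) minnC maxnC (minnC b) (maxnC b).
  case: (leqP a b) => // ab'; lia.
rewrite !minn0 !maxn0 minnC maxnC (minnC b) (maxnC b).
case: (leqP a b) => // ab'; lia.
Qed.

Lemma all_chords_arcs s0 s pos m v0 : circular s0 -> numbering pos -> turns s0 pos ->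
  round R pos -> circular s -> (forall v, is_arc s (N v)) ->
  1 < m -> m.+1 < #|T| -> ~: N v0 = itv pos 0 m ->
  forall a b : 'I_#|T|, is_arc s (chord pos a b).
Proof.
move=> circ0 num ts rnd circ arcN m1 mn v0E a b.
have n0 : 0 < #|T| by clear -mn; lia.
pose i0 := Ordinal n0; have mn' : m < #|T| by exact: ltnW.
pose im := Ordinal mn'.
have clS0 : arc_clique s pos setT [set i0; im].
  have arc0m : is_arc s (chord pos i0 im).
    by rewrite chord_leq // -v0E; exact: is_arcC.
  rewrite /arc_clique subsetT; apply/forall_inP => i /set2P iP.
  apply/forall_inP => j /set2P jP.
  by case: iP => ->; case: jP => ->; rewrite ?is_arc_chord_refl // chordC.
have [S maxS /subsetP subS] := maxset_exists clS0.
have i0S : i0 \in S by apply: subS; rewrite !inE eqxx.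
have imS : im \in S by apply: subS; rewrite !inE eqxx orbT.
have clS : arc_clique s pos setT S by case/maxsetP: maxS.
suff ST (x : 'I_#|T|) : x \in S by exact: arc_cliqueP clS (ST a) (ST b).
apply: contraT => xS.
have x0 : i0 < x.
  by rewrite lt0n; apply: contraNneq xS => x0; rewrite (_ : x = i0) //; exact: val_inj.
have [c [d [cS /andP [cx xd] dn dP gapS]]] := gap xS i0S x0.
have cn := ltn_ord c.
have [pos' [num' rot]] := numbering_rotation num cn.
have rnd' := round_rotation num cn rot rnd.
have inA v : (pos' v < d - c) = (c <= pos v < d).
  by have := rot v; have := num.2 v; clear -cx xd dn cn; lia.
have [v [u1 [u2 [w1 [w2 [[u1c u2c w1c w2c] [u1N u2N w1N w2N]]]]]]] :
  exists v u1 u2 w1 w2,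
   [/\ pos' u1 < d - c, pos' u2 < d - c, d - c <= pos' w1 & d - c <= pos' w2] /\
   [/\ u1 \in N v, u2 \notin N v, w1 \in N v & w2 \notin N v].
  apply: (round_crossing e_sym e_irr orientedP e_conn e_twin_free _ num' rnd' _ _ nbip).
  - by move=> v; exact: (nonneighbor e_sym orientedP nbip v num rnd).
  - by clear -cx xd; lia.
  - by have : m <= c \/ d <= m := gapS _ imS; clear -cx xd dn m1 mn; lia.
rewrite inA in u1c; rewrite inA in u2c.
rewrite leqNgt inA in w1c; rewrite leqNgt inA in w2c.
have arcN0 : is_arc s0 (N v).
  exact: (round_is_arc orientedP v circ0 num ts rnd).
have [||p [q [pq NE]]] := arc_chord circ0 num ts arcN0.
- by apply/set0Pn; exists u1.
- by apply: contraNneq u2N => ->; rewrite inE.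
have arc_pq : is_arc s (chord pos p q).
  rewrite chord_leq ?(ltnW pq) //; case: NE => NE; first by rewrite -NE.
  by rewrite -[itv _ _ _]setCK -NE; exact: is_arcC.
pose d' := if d < #|T| then d else 0.
have [e' [e'S e'E]] : exists e' : 'I_#|T|, e' \in S /\ e' = d' :> nat.
  rewrite /d'; case: dP => [->|[j jS ->]]; first by exists i0; rewrite ltnn.
  by exists j; rewrite ltn_ord.
have cross : (c < p < d) && crossing c d' p q || (c < q < d) && crossing c d' q p.
  have cd : c < d by exact: ltn_trans xd.
  case: NE => NE.
    exact: (crossing_of_split pq NE cd dn num.2 u1c u2c w1c w2c).
  have NE' : ~: N v = itv pos p q by rewrite NE setCK.
  by apply: (crossing_of_split pq NE' cd dn num.2 u2c u1c w2c w1c); rewrite inE ?negbK.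
have inside (i : 'I_#|T|) : i \in S -> c < i < d -> False.
  by move=> iS; have := gapS i iS; clear; lia.
rewrite -e'E in cross; case/orP: cross => /andP [ins cr].
  by case: (inside p) => //; exact: (crossing_maxset circ num maxS cS e'S (in_setT _) cr arc_pq).
rewrite chordC in arc_pq.
by case: (inside q) => //; exact: (crossing_maxset circ num maxS cS e'S (in_setT _) cr arc_pq).
Qed.

Lemma arc_ordering_uniq s0 s pos : circular s0 -> numbering pos -> turns s0 pos ->
  round R pos -> arc_ordering (nbh_hypergraph e) s -> s = s0 \/ s = s0^-1%g.
Proof.
move=> circ0 num ts rnd /andP [circ /forall_inP arcH].
have arcN v : is_arc s (N v) by apply: arcH; exact: imset_f.
have [v0 small] := proper_nonneighborhood e_sym e_irr e_conn nbip num.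
have num0 := num.2 v0.
have [pos1 [num1 rot1]] := numbering_rotation num num0.
have rnd1 := round_rotation num num0 rot1 rnd.
have ts1 := turns_rotation num num0 ts rot1.
have v00 : pos1 v0 = 0 by have := rot1 v0; clear; lia.
have [b [a [/andP [b0 _] an _ _ KE]]] := nbh_itv orientedP num1 rnd1 v00.
have cardK : #|~: N v0| = a - b by rewrite KE card_itv.
have bn : b < #|T| by clear -small cardK an; lia.
have [pos2 [num2 rot2]] := numbering_rotation num1 bn.
have rnd2 := round_rotation num1 bn rot2 rnd1.
have ts2 := turns_rotation num1 bn ts1 rot2.
have KE2 : ~: N v0 = itv pos2 0 (a - b) by rewrite KE -(itv_rotation rot2 (leqnn b) an) subnn.
have m1 : 1 < a - b by clear -small cardK; lia.
have mn : (a - b).+1 < #|T| by clear -small cardK; lia.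
have chords := all_chords_arcs circ0 num2 ts2 rnd2 circ arcN m1 mn KE2.
have adj u w : 0 <= pos2 u -> pos2 w = (pos2 u).+1 -> pos2 w < #|T| -> s u = w \/ s w = u.
  move=> _ uw wn; apply: is_arc_pair => //.
    by apply: contra_eq_neq uw => ->; clear; lia.
  have un := num2.2 u.
  have inU x : (x \in [set u; w]) = (pos2 x == pos2 u) || (pos2 x == pos2 w).
    by rewrite !inE !(inj_eq num2.1).
  have [wl|wl] := ltnP (pos2 w).+1 #|T|.
    rewrite (_ : [set u; w] = chord pos2 (Ordinal un) (Ordinal wl)); first exact: chords.
    rewrite chord_leq /=; last by clear -uw; lia.
    by apply/setP => x; rewrite inU inE; clear -uw; lia.
  have n0 : 0 < #|T| by clear -un; lia.
  rewrite (_ : [set u; w] = ~: chord pos2 (Ordinal n0) (Ordinal un)); first exact: is_arcC.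
  rewrite chord_leq //=; apply/setP => x; rewrite inU !inE.
  by have := num2.2 x; clear -uw wl; lia.
have n1 : 1 < #|T| by clear -m1 mn; lia.
have n0 : 0 < #|T| by exact: ltnW.
have [fw|bw] := forward_or_backward circ num2 (leqnn _) n1 adj; [left|right].
  apply: (turns_uniq num2 _ ts2); apply: (forward_turns circ num2 n0 (leqnn _)) => u w uw _.
  by apply: fw => //; exact: num2.2.
rewrite -[s]invgK; congr (_^-1)%g; apply: (turns_uniq num2 _ ts2).
apply: (forward_turns (circularV circ) num2 n0 (leqnn _)) => u w uw _.
by apply: bw => //; exact: num2.2.
Qed.

End NonBipartiteUniqueness.

(** * Connected bipartite complement *)

Section Bipartite.

Variable T : finType.
Implicit Types (s : {perm T}) (pos : T -> nat) (A B : {set T}).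

Lemma connected_closed (r : rel T) (W : {set T}) x y : connected_graph r ->
  (forall u v, r u v -> u \in W -> v \in W) -> x \in W -> y \in W.
Proof.
move=> conn closedW; have /connectP [c] := conn x y.
elim: c x => [|z c IH] x /=; first by move=> _ ->.
by case/andP => xz zc yl xW; apply: (IH z) => //; exact: closedW xz xW.
Qed.

Lemma arc_prefix s A : circular s -> is_arc s A -> A != set0 ->
  exists pos m, [/\ numbering pos, turns s pos & A = itv pos 0 m].
Proof.
move=> circ arcA A0; move: arcA; rewrite /is_arc (negPf A0) /=.
case/existsP => a /existsP [b /eqP ->].
have [pos [num ts a0]] := numbering_turn a circ.
exists pos, (pos b).+1; split=> //; rewrite (vertex_arcE b circ num ts a0).
by apply/setP => v; rewrite !inE.
Qed.

Lemma sub_arc_itv s pos lo hi A : circular s -> numbering pos -> turns s pos ->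
  0 < lo \/ hi < #|T| -> is_arc s A -> A != set0 -> A \subset itv pos lo hi ->
  exists a b, [/\ lo <= a, a < b, b <= hi, b <= #|T| & A = itv pos a b].
Proof.
move=> circ num ts lohi arcA A0 sub.
have AT : A != setT.
  apply: contraTneq sub => ->; apply/subsetP => subT.
  have /set0Pn [z _] := A0; have zn := num.2 z.
  have [x xE] : exists x, pos x = 0 by apply: (pos_surj num); clear -zn; lia.
  have [y yE] : exists x, pos x = #|T|.-1 by apply: (pos_surj num); clear -zn; lia.
  have := subT x (in_setT _); have := subT y (in_setT _); rewrite !inE xE yE.
  by clear -zn lohi; lia.
have [a [b [ab AE]]] := arc_chord circ num ts arcA A0 AT.
have bn := ltn_ord b; have final i j : i < j -> j <= #|T| -> A = itv pos i j ->
    exists a b, [/\ lo <= a, a < b, b <= hi, b <= #|T| & A = itv pos a b].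
  move=> ij jn E; rewrite E in sub; have [? ?] := itv_sub num ij jn sub.
  by exists i, j; split.
case: AE => AE; first by apply: final AE => //; exact: ltnW.
have [a0|a0] := posnP a.
  apply: (final b #|T|) => //; rewrite AE; apply/setP => v; rewrite !inE a0.
  by have := num.2 v; clear; lia.
have [x xE] : exists x, pos x = 0 by apply: (pos_surj num); clear -bn; lia.
have [y yE] : exists x, pos x = #|T|.-1 by apply: (pos_surj num); clear -bn; lia.
have := subsetP sub x; have := subsetP sub y; rewrite AE !inE xE yE.
by clear -bn a0 ab lohi; lia.
Qed.

Variable e : rel T.
Hypotheses (e_sym : symmetric e) (e_irr : irreflexive e).
Hypothesis e_conn : connected_graph e.
Hypothesis e_twin_free : twin_free e.
Hypothesis c_conn : connected_graph (compl_graph e).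
Hypothesis n_gt1 : 1 < #|T|.

Variable side : T -> bool.
Hypothesis sideP : forall u v, compl_graph e u v -> side u != side v.

Local Notation N := (closed_nbh e).
Local Notation H := (nbh_hypergraph e).
Local Notation X c := [set v | side v == c].

Lemma in_conbh u v : (u \in ~: N v) = compl_graph e v u.
Proof. by rewrite inE inE negb_or eq_sym. Qed.

Lemma conbh_sym u v : (u \in ~: N v) = (v \in ~: N u).
Proof. by rewrite !in_conbh /compl_graph /= eq_sym e_sym. Qed.

Lemma conbh_side u v : u \in ~: N v -> side u = ~~ side v.
Proof. by rewrite in_conbh => /sideP; case: (side u); case: (side v). Qed.

Lemma conbh_sub v : ~: N v \subset X (~~ side v).
Proof. by apply/subsetP => u /conbh_side uv; rewrite inE uv. Qed.

Lemma conbh_neq0 v : ~: N v != set0.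
Proof.
have c_irr : irreflexive (compl_graph e) by move=> x; rewrite /compl_graph /= eqxx.
have [u uv] := neighbor c_irr c_conn v n_gt1.
rewrite inE (negPf uv) /= -in_conbh => uK; by apply/set0Pn; exists u.
Qed.

Lemma nbh_neq0 v : N v != set0.
Proof. by apply/set0Pn; exists v; rewrite inE eqxx. Qed.

Lemma nbh_neqT v : N v != setT.
Proof. by rewrite -(inj_eq (@setC_inj T)) setCT conbh_neq0. Qed.

Lemma separating u u' : u != u' -> exists y, (u \in ~: N y) != (u' \in ~: N y).
Proof.
move=> uu'; apply/existsP; apply: contraNT (e_twin_free uu') => /existsPn same.
apply/eqP; apply: (@setC_inj T); apply/setP => y.
by have := same y; rewrite negbK conbh_sym (conbh_sym u') => /eqP.
Qed.

Lemma side_card c : 1 < #|X c|.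
Proof.
rewrite ltnNge; apply/negP => small.
have KE y : side y = ~~ c -> ~: N y = X c.
  move=> yc; apply/eqP; rewrite eqEcard (leq_trans small) ?card_gt0 ?conbh_neq0 // andbT.
  by have := conbh_sub y; rewrite yc negbK.
have small' y y' : side y = ~~ c -> side y' = ~~ c -> y = y'.
  move=> yc y'c; apply/eqP; apply: contraT => /e_twin_free /negP []; apply/eqP.
  by apply: (@setC_inj T); rewrite !KE.
have small2 y y' : side y = side y' -> y = y'.
  have [yc|yc] := boolP (side y == c) => E.
    by apply: (card_le1_eqP small); rewrite inE -?E.
  have yc' : side y = ~~ c by move: yc; clear; case: (side y) c => [] [].
  by apply: small'; rewrite -?E.
have [v _] : exists v : T, true by have /card_gt0P [v _] := ltnW n_gt1; exists v.
have [u uv uN] := neighbor e_irr e_conn v n_gt1.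
have /set0Pn [w wK] := conbh_neq0 v; have wv := conbh_side wK.
have [uw|uw] := eqVneq (side u) (side w).
  by move: wK; rewrite -(small2 _ _ uw) inE uN.
by case/eqP: uv; apply: small2; move: uw; rewrite wv; case: (side u); case: (side v).
Qed.

Lemma straddling c A : A != set0 -> A \proper X c ->
  exists y, [/\ side y = ~~ c, ~: N y :&: A != set0 & ~: N y :&: (X c :\: A) != set0].
Proof.
move=> /set0Pn [a aA] /properP [AX [x xX xA]].
have [/existsP [y /and3P [/eqP yc yA yX]]|none] := boolP [exists y, [&& side y == ~~ c,
   ~: N y :&: A != set0 & ~: N y :&: (X c :\: A) != set0]]; first by exists y.
pose W := A :|: [set y | (side y == ~~ c) && (~: N y :&: A != set0)].
have : x \in W.
  have aW : a \in W by rewrite inE aA.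
  apply: connected_closed c_conn _ aW.
  move=> u v; rewrite -in_conbh => uv; rewrite !inE => /orP [uA|/andP [uc uK]].
    have /= := subsetP AX u uA; rewrite inE => /eqP uc.
    apply/orP; right; rewrite (conbh_side uv) uc eqxx /=; apply/set0Pn; exists u.
    by rewrite inE conbh_sym uv.
  apply/orP; left; apply: contraNT none => vA; apply/existsP; exists u.
  rewrite uc uK /=; apply/set0Pn; exists v; rewrite inE uv !inE vA /=.
  by rewrite (conbh_side uv) (eqP uc) negbK.
rewrite !inE (negPf xA) /= => /andP [/eqP xc _].
by move: xX; rewrite inE xc; case: (c).
Qed.

Lemma side_is_arc s c : arc_ordering H s -> is_arc s (X c).
Proof.
move=> /andP [circ /forall_inP arcH].
have arcK v : is_arc s (~: N v) by apply: is_arcC => //; apply: arcH; exact: imset_f.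
have /card_gt0P [p] : 0 < #|X (~~ c)| by apply: ltnW; exact: side_card.
rewrite inE => /eqP pc.
pose good A := [&& A \subset X c, is_arc s A & A != set0].
have good0 : good (~: N p).
  by rewrite /good arcK conbh_neq0 /= andbT; have := conbh_sub p; rewrite pc negbK.
have [A /maxsetP [/and3P [AX arcA A0] Amax] _] := maxset_exists good0.
have [<- //|AX'] := eqVneq A (X c).
have [y [yc /set0Pn [z]]] : exists y, [/\ side y = ~~ c, ~: N y :&: A != set0
    & ~: N y :&: (X c :\: A) != set0] by apply: straddling => //; rewrite properEneq AX'.
rewrite setIC => zI /set0Pn [x /setIP [xK /setDP [_ xA]]].
have UX : A :|: ~: N y \subset X c.
  by rewrite subUset AX /=; have := conbh_sub y; rewrite yc negbK.
have pU : p \notin A :|: ~: N y.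
  by apply/negP => /(subsetP UX); rewrite inE pc; case: (c).
have [_ arcU] := overlap_arcs circ arcA (arcK y) pU zI.
have : x \in A; last by rewrite (negPf xA).
rewrite -(Amax (A :|: ~: N y)) ?subsetUl //; first by rewrite inE xK orbT.
rewrite /good UX arcU /=; apply/set0Pn; exists x; by rewrite inE xK orbT.
Qed.

Section Block.

Variables (s0 : {perm T}) (pos : T -> nat) (m : nat) (c : bool).
Hypothesis s0_tight : tight_arc_ordering H s0.
Hypotheses (num : numbering pos) (ts : turns s0 pos).
Hypothesis blockE : X c = itv pos 0 m.
Hypothesis m_lt : m < #|T|.

Let circ0 : circular s0.
Proof. by case/andP: s0_tight => /andP []. Qed.

Let arcN0 v : is_arc s0 (N v).
Proof. by case/andP: s0_tight => /andP [_ /forall_inP arcH] _; apply: arcH; exact: imset_f. Qed.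

Lemma conbh_itv y : side y = ~~ c ->
  exists a b, [/\ a < b, b <= m & ~: N y = itv pos a b].
Proof.
move=> yc; have sub : ~: N y \subset itv pos 0 m.
  by rewrite -blockE; have := conbh_sub y; rewrite yc negbK.
have arcK := is_arcC circ0 (arcN0 y).
have [a [b [_ ab bm _ KE]]] :=
  sub_arc_itv circ0 num ts (or_intror m_lt) arcK (conbh_neq0 y) sub.
by exists a, b.
Qed.

Lemma nested_conbh y y' a b a' b' : a < b -> b' <= #|T| ->
  ~: N y = itv pos a b -> ~: N y' = itv pos a' b' -> a' <= a -> b <= b' ->
  (a = a' \/ b = b') /\
  (forall s, tight_arc_ordering H s -> is_arc s (~: N y' :\: ~: N y)).
Proof.
move=> ab bn yE y'E aa bb.
have sub : N y' \subset N y.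
  rewrite -setCS yE y'E; apply/subsetP => v; rewrite !inE; clear -aa bb; lia.
have yH v : N v \in H by exact: imset_f.
split=> [|s /andP [ordH tH]].
  have [ordH tH] := andP s0_tight.
  have touch := tight_touching circ0 ordH tH (yH _) (yH _) (nbh_neq0 _) sub (nbh_neqT _).
  exact: (touching_itv circ0 num ts y'E yE (nbh_neq0 _) aa ab bb bn).1.
have circ : circular s by case/andP: ordH.
have := tight_diff circ ordH tH (yH y') (yH y) (nbh_neq0 _) sub (nbh_neqT _).
by rewrite [~: _ :\: _]setDE setCK setIC -setDE.
Qed.

Lemma block_chords s : tight_arc_ordering H s ->
  forall i j : 'I_#|T|, i <= m -> j <= m -> is_arc s (chord pos i j).
Proof.
move=> s_tight; have [ordH tH] := andP s_tight; have [circ /forall_inP arcH] := andP ordH.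
have arcK v : is_arc s (~: N v) by apply: is_arcC => //; apply: arcH; exact: imset_f.
have inX v : (side v == c) = (pos v < m) by move/setP/(_ v): blockE; rewrite !inE.
have m1 : 1 < m by rewrite -(subn0 m) -(card_itv 0 num (ltnW m_lt)) -blockE side_card.
have n0 : 0 < #|T| by exact: leq_ltn_trans m_lt.
have oside y x : x \in ~: N y -> pos x < m -> side y = ~~ c.
  by move=> /conbh_side xy; rewrite -inX xy => /eqP <-; rewrite negbK.
have [x0 x0E] : exists x, pos x = 0 by exact: (pos_surj num).
pose through y := x0 \in ~: N y.
have [y1 y1P] : exists y, through y.
  by have /set0Pn [y yK] := conbh_neq0 x0; exists y; rewrite /through conbh_sym.
case: (@arg_maxnP _ y1 through (fun y => #|~: N y|) y1P) => y0 y0P y0max.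
have [|a0 [k [a0k km y0E]]] := conbh_itv (y := y0); first by apply: oside y0P _; rewrite x0E ltnW.
have {}a0E : a0 = 0 by move: y0P; rewrite /through y0E inE x0E; clear; lia.
rewrite a0E in a0k y0E => {a0 a0E}.
have prefix_le y b : ~: N y = itv pos 0 b -> 0 < b -> b <= m -> b <= k.
  move=> yE b0 bm; have := y0max y; rewrite /through yE inE x0E b0 => /(_ isT).
  by rewrite y0E /= !card_itv ?subn0 //; apply: leq_trans (ltnW m_lt).
have kn : k < #|T| by exact: leq_ltn_trans m_lt.
pose i0 := Ordinal n0; pose ik := Ordinal kn; pose im := Ordinal m_lt.
pose W := [set i : 'I_#|T| | i <= m].
have clS0 : arc_clique s pos W [set i0; ik].
  have arc0k : is_arc s (chord pos i0 ik) by rewrite chord_leq // -y0E.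
  apply/andP; split; first by apply/subsetP => i /set2P [] ->; rewrite inE.
  apply/forall_inP => i /set2P iP; apply/forall_inP => j /set2P jP.
  by case: iP => ->; case: jP => ->; rewrite ?is_arc_chord_refl // chordC.
have [S maxS /subsetP subS] := maxset_exists clS0.
have i0S : i0 \in S by apply: subS; rewrite !inE eqxx.
have ikS : ik \in S by apply: subS; rewrite !inE eqxx orbT.
have clS : arc_clique s pos W S by case/maxsetP: maxS.
have SW (i : 'I_#|T|) : i \in S -> i <= m.
  by case/andP: clS => /subsetP SW _ /SW; rewrite inE.
have crossS (c1 c2 : 'I_#|T|) a b (an : a < #|T|) : c1 \in S -> c2 \in S -> a <= m ->
    crossing c1 c2 a b -> is_arc s (chord pos a b) -> b < #|T| -> Ordinal an \in S.
  move=> c1S c2S am cr arcab bn.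
  apply: (crossing_maxset (x := Ordinal an) (y := Ordinal bn) circ num maxS c1S c2S _ cr arcab).
  by rewrite inE.
have blockS : im \in S.
  case: (@arg_maxnP _ i0 (mem S) (fun i => i : nat) i0S) => t tS tmax.
  have [tm|mt] := ltnP t m; last first.
    by rewrite (_ : im = t) //; apply: val_inj => /=; apply/eqP; rewrite eqn_leq mt SW.
  have kt : k <= t by exact: (tmax ik).
  have [y [yc /set0Pn [u uI] /set0Pn [v vI]]] : exists y, [/\ side y = ~~ c,
      ~: N y :&: itv pos 0 t != set0 & ~: N y :&: (X c :\: itv pos 0 t) != set0].
    apply: straddling; first by apply/set0Pn; exists x0; rewrite inE x0E; clear -a0k kt; lia.
    rewrite properE blockE; apply/andP; split; apply/subsetP.
      by move=> v; rewrite !inE; clear -tm; lia.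
    have [x xE] : exists x, pos x = t by apply: (pos_surj num); exact: ltn_ord.
    by move/(_ x); rewrite !inE xE tm ltnn => /(_ isT).
  have [a [b [ab bm yE]]] := conbh_itv yc.
  move: uI vI; rewrite yE !inE /= => uI /and3P [/andP [_ vb] vt _].
  have at_ : a < t by case/andP: uI => /andP [ua _] /(leq_ltn_trans ua).
  have tb : t < b by rewrite -leqNgt in vt; exact: leq_ltn_trans vb.
  have [a0|a0] := posnP a.
    have := prefix_le y b; rewrite -a0 => /(_ yE) le.
    by move: tb; rewrite ltnNge (leq_trans (le _ bm) kt) // (leq_ltn_trans _ ab).
  have bn : b < #|T| by exact: leq_ltn_trans m_lt.
  have /negP [] : Ordinal bn \notin S by apply/negP => /tmax /=; rewrite leqNgt tb.
  apply: (crossS i0 t b a bn) => //.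
  - by rewrite /crossing !min0n !max0n (minn_idPr (ltnW ab)) (maxn_idPl (ltnW ab)) a0 at_ tb.
  - by rewrite chordC chord_leq ?(ltnW ab) // -yE.
  - by exact: ltn_trans bn.
suff inS (x : 'I_#|T|) : x <= m -> x \in S.
  by move=> i j im' jm'; apply: arc_cliqueP clS (inS i im') (inS j jm').
move=> xm; apply: contraT => xS.
have x_gt0 : i0 < x.
  by rewrite lt0n; apply: contraNneq xS => x0'; rewrite (_ : x = i0) //; exact: val_inj.
have [c1 [d [c1S /andP [cx xd] dn dP gapS]]] := gap xS i0S x_gt0.
have dm : d <= m.
  by have [|//] := gapS _ blockS; rewrite leqNgt /= (leq_trans cx xm).
have [j jS dj] : exists2 j : 'I_#|T|, j \in S & d = j.
  by case: dP => // dn'; move: dm; rewrite dn' leqNgt m_lt.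
have inside (i : 'I_#|T|) : i \in S -> c1 < i < d -> False.
  by move=> iS; have := gapS i iS; clear; lia.
have c1n := ltn_ord c1.
have xq : c1.+1 < d by exact: leq_ltn_trans xd.
have pm : c1.+1 < m by exact: leq_trans dm.
have pn : c1.+1 < #|T| by exact: ltn_trans m_lt.
have pd : c1 < c1.+1 < d by rewrite ltnSn.
have cd : c1 <= d by apply: ltnW; exact: ltn_trans xd.
have nocross i l : i < l -> l <= m -> is_arc s (itv pos i l) ->
    (c1 < i < d -> d < l -> False) /\ (i < c1 -> c1 < l < d -> False).
  move=> il lm arcil; have ln : l < #|T| by exact: leq_ltn_trans m_lt.
  have i_n : i < #|T| by exact: ltn_trans ln.
  split=> [ci dl|ic cl].
    apply: (inside (Ordinal i_n)) => //; apply: (crossS c1 j i l i_n) => //.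
    - exact: leq_trans (ltnW il) lm.
    - move: ci; rewrite /crossing -dj (minn_idPl cd) (maxn_idPr cd).
      by rewrite (minn_idPl (ltnW il)) (maxn_idPr (ltnW il)) dl => ->.
    - by rewrite chord_leq // ltnW.
  apply: (inside (Ordinal ln)) => //; apply: (crossS c1 j l i ln) => //.
  - move: cl; rewrite /crossing -dj (minn_idPl cd) (maxn_idPr cd).
    by rewrite (minn_idPr (ltnW il)) (maxn_idPl (ltnW il)) ic orbC => /andP [-> ->].
  - by rewrite chordC chord_leq // ltnW.
have [u uE] := pos_surj num c1n; have [u' u'E] := pos_surj num pn.
have uu' : u != u' by rewrite -(inj_eq num.1) uE u'E neq_ltn ltnSn.
have [y ysep] := separating uu'.
have yc : side y = ~~ c.
  have [uK|uK] := boolP (u \in ~: N y).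
    by apply: oside uK _; rewrite uE; exact: ltnW.
  by apply: (oside y u'); rewrite ?u'E //; move: ysep; rewrite (negPf uK); case: (_ \in _).
have [a [b [ab bm yE]]] := conbh_itv yc.
have ends : a = c1.+1 \/ b = c1.+1 by move: ysep; rewrite yE !inE uE u'E; clear -ab; lia.
have arcy : is_arc s (itv pos a b) by rewrite -yE.
have [nc1 nc2] := nocross a b ab bm arcy.
have [ca bd] : c1 <= a /\ b <= d.
  by case: ends => E; split; move: nc1 nc2 ab pd; rewrite E; clear; lia.
have mn := ltnW m_lt.
have [/andP [/eqP c10 /eqP dm']|inner] := boolP ((nat_of_ord c1 == 0) && (d == m)).
  have km' : k = m.
    by have := gapS ik ikS; rewrite /= c10 dm' => -[]; move: a0k km; clear; lia.
  rewrite km' in y0E.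
  have [ab0 diff] := nested_conbh ab mn yE y0E (leq0n a) bm.
  have := diff s s_tight; rewrite yE y0E => arcD.
  case: (inside (Ordinal pn)) => //.
  apply: (maxset_arc_clique maxS); first by rewrite inE /= ltnW.
  move=> i iS; have im' : i <= m := SW i iS.
  have [i0'|i_m] : nat_of_ord i = 0 \/ nat_of_ord i = m.
    by have := gapS i iS; rewrite c10 dm'; move: im'; clear; lia.
    rewrite i0' chordC chord_leq //=; case: ends => E; last first.
      have a0 : a = 0 by move: ca ab; rewrite E c10; clear; lia.
      by move: arcy; rewrite a0 E.
    have bE : b = m by case: ab0 => //; rewrite E.
    rewrite (_ : itv _ _ _ = itv pos 0 m :\: itv pos a b) //.
    by apply/setP => v; rewrite !inE E bE; move: pm; move: (nat_of_ord c1) => q; clear; lia.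
  rewrite i_m chord_leq /=; last by exact: ltnW.
  case: ends => E.
    have bE : b = m by case: ab0 => //; rewrite E.
    by move: arcy; rewrite bE E.
  have aE : a = 0 by move: ca ab; rewrite E c10; clear; lia.
  rewrite (_ : itv _ _ _ = itv pos 0 m :\: itv pos a b) //.
  by apply/setP => v; rewrite !inE E aE; move: pm; move: (nat_of_ord c1) => q; clear; lia.
have [y' [y'c /set0Pn [w wI] /set0Pn [w' w'I]]] : exists y', [/\ side y' = ~~ c,
    ~: N y' :&: itv pos c1 d != set0 & ~: N y' :&: (X c :\: itv pos c1 d) != set0].
  apply: straddling; first by apply/set0Pn; exists u; rewrite inE uE leqnn; move: pd; clear; lia.
  rewrite blockE properE; apply/andP; split; apply/subsetP.
    by move=> v; rewrite !inE; move: dm; clear; lia.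
  have [l lE] : exists l, pos l = m.-1 by apply: (pos_surj num); move: m1 m_lt; clear; lia.
  move=> sub; have := sub x0; have := sub l; rewrite !inE x0E lE.
  by move: inner m1 pm dm; clear; lia.
have [a' [b' [ab' bm' y'E]]] := conbh_itv y'c.
have arcy' : is_arc s (itv pos a' b') by rewrite -y'E.
have [nc1' nc2'] := nocross a' b' ab' bm' arcy'.
have [a'c b'd] : a' <= c1 /\ d <= b'.
  move: wI w'I; rewrite y'E blockE !inE; move: nc1' nc2' ab' pd; clear; lia.
have [ab0 diff] := nested_conbh ab (leq_trans bm' mn) yE y'E (leq_trans a'c ca) (leq_trans bd b'd).
have := diff s s_tight; rewrite yE y'E => arcD.
case: ends => E.
  have bb : b = b' by case: ab0 => // aa; move: a'c; rewrite -aa E ltnn.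
  have arcD' : is_arc s (itv pos a' c1.+1).
    rewrite (_ : itv _ _ _ = itv pos a' b' :\: itv pos a b) //.
    apply/setP => v; rewrite !inE E -bb; move: ab a'c; rewrite E.
    by move: (nat_of_ord c1) => q; clear; lia.
  have a'c1 : a' < c1.
    move: w'I; rewrite y'E blockE !inE; move: bb bd b'd a'c ab.
    by move: (nat_of_ord c1) => q; clear; lia.
  by have [_] := nocross a' c1.+1 (ltnW a'c1) (ltnW pm) arcD'; case/(_ a'c1 pd).
have aa : a = a' by case: ab0 => // bb; move: b'd pd; rewrite -bb E; clear; lia.
have arcD' : is_arc s (itv pos c1.+1 b').
  rewrite (_ : itv _ _ _ = itv pos a' b' :\: itv pos a b) //.
  apply/setP => v; rewrite !inE E -aa; move: ab bd b'd; rewrite E.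
  by move: (nat_of_ord c1) => q; clear; lia.
have db' : d < b'.
  move: w'I; rewrite y'E blockE !inE; move: aa ca b'd a'c ab'.
  by move: (nat_of_ord c1) => q; clear; lia.
have pb' : c1.+1 < b' by exact: ltn_trans xq db'.
by have [nc _] := nocross c1.+1 b' pb' bm' arcD'; case/(_ pd db'): nc.
Qed.

Lemma block_adjacent s u w : tight_arc_ordering H s ->
  pos w = (pos u).+1 -> pos w < m -> s u = w \/ s w = u.
Proof.
move=> s_tight uw wm; have circ : circular s by case/andP: s_tight => /andP [].
apply: is_arc_pair => //; first by apply: contra_eq_neq uw => ->; rewrite neq_ltn ltnSn.
have un := num.2 u; have wn : (pos w).+1 < #|T| by exact: leq_ltn_trans m_lt.
rewrite (_ : [set u; w] = chord pos (Ordinal un) (Ordinal wn)).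
  by apply: block_chords => //=; rewrite ltnW // -uw ltnW.
rewrite chord_leq /=; last by rewrite uw !leqW.
by apply/setP => x; rewrite !inE -!(inj_eq num.1); clear -uw; lia.
Qed.

End Block.

Lemma two_tight_orderings s0 : tight_arc_ordering H s0 ->
  exists s1, [/\ tight_arc_ordering H s1, s1 != s0, s1 != s0^-1%g &
    forall s, tight_arc_ordering H s -> [\/ s = s0, s = s0^-1%g, s = s1 | s = s1^-1%g]].
Proof.
move=> s0_tight; have [ord0 tight0] := andP s0_tight.
have [circ0 /forall_inP arcH0] := andP ord0.
have X0 : X true != set0 by rewrite -card_gt0 ltnW // side_card.
have [pos [m [num ts XE]]] := arc_prefix circ0 (side_is_arc true ord0) X0.
have [pos_inj pos_lt] := num.
have inX v : side v = (pos v < m) by move/setP/(_ v): XE; rewrite !inE eqb_id.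
have mn : m < #|T|.
  have /card_gt0P [y] := ltnW (side_card false).
  by rewrite inE inX eqbF_neg -leqNgt => my; exact: leq_ltn_trans (pos_lt y).
have m1 : 1 < m by rewrite -(subn0 m) -(card_itv 0 num (ltnW mn)) -XE side_card.
have YE : X false = itv pos m #|T|.
  by apply/setP => v; rewrite !inE inX pos_lt andbT eqbF_neg -leqNgt.
have nm1 : 1 < #|T| - m by rewrite -(card_itv m num (leqnn _)) -YE side_card.
have [pos' [num' rot]] := numbering_rotation num mn.
have ts' := turns_rotation num mn ts rot.
have YE' : X false = itv pos' 0 (#|T| - m).
  by rewrite YE -(itv_rotation rot (leqnn m) (leqnn _)) subnn.
have mn' : #|T| - m < #|T| by rewrite ltn_subrL ltnW //= ltnW.
pose pos1 v := if pos v < m then m.-1 - pos v else pos v.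
have pos1P v : (pos v < m) && (pos1 v == m.-1 - pos v) || (m <= pos v) && (pos1 v == pos v).
  by rewrite /pos1; case: ltnP => /=; rewrite eqxx.
have num1 : numbering pos1.
  split=> [u v uv|v]; last by have := pos1P v; have := pos_lt v; clear -mn; lia.
  by apply: pos_inj; have := pos1P u; have := pos1P v; rewrite uv; clear; lia.
have [s1 [circ1 ts1]] := turn_numbering num1.
have KP v : exists a b a1 b1, [/\ ~: N v = itv pos a b, ~: N v = itv pos1 a1 b1, a < b <= #|T| &
    if side v then m <= a /\ a1 = a /\ b1 = b else b <= m /\ a1 = m - b /\ b1 = m - a].
  case vX : (side v).
    have [a [b [ab bm KE]]] := conbh_itv s0_tight num' ts' YE' mn' (y := v) vX.
    have KE' : ~: N v = itv pos (a + m) (b + m).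
      rewrite KE -(itv_rotation rot (leq_addl _ _)); first by rewrite !addnK.
      by move: bm mn; clear; lia.
    exists (a + m), (b + m), (a + m), (b + m); split=> //.
    - by rewrite KE'; apply/setP => x; rewrite !inE; have := pos1P x; clear; lia.
    - by move: ab bm mn; clear; lia.
    - by rewrite leq_addl.
  have [a [b [ab bm KE]]] := conbh_itv s0_tight num ts XE mn (y := v) vX.
  exists a, b, (m - b), (m - a); split=> //.
  - by rewrite KE; apply/setP => x; rewrite !inE; have := pos1P x; move: ab bm; clear; lia.
  - by rewrite ab (leq_trans bm) // ltnW.
have ord1 : arc_ordering H s1.
  apply/andP; split=> //; apply/forall_inP => _ /imsetP [v _ ->].
  have [a [b [a1 [b1 [_ KE1 _ _]]]]] := KP v.
  by apply/(is_arcP _ circ1 num1 ts1); exists a1, b1; right; rewrite -KE1 setCK.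
have tight1 : tight H s1.
  apply: touching_tight => // _ _ /imsetP [u _ ->] /imsetP [v _ ->] _ sub _.
  have touch := tight_touching circ0 ord0 tight0 (imset_f _ isT) (imset_f _ isT)
    (nbh_neq0 u) sub (nbh_neqT v).
  have subK : ~: N v \subset ~: N u by rewrite setCS.
  have uv : side u = side v.
    have /set0Pn [x xv] := conbh_neq0 v; have xu := subsetP subK x xv.
    by apply: negb_inj; rewrite -(conbh_side xv) -(conbh_side xu).
  have [a [b [a1 [b1 [KE KE1 /andP [ab bn] sd]]]]] := KP u.
  have [i [j [i1 [j1 [LE LE1 /andP [ij jn] sd']]]]] := KP v.
  rewrite KE LE in subK; have [ai jb] := itv_sub num ij jn subK.
  have := (touching_itv circ0 num ts KE LE (nbh_neq0 u) ai ij jb bn).1 touch.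
  rewrite uv in sd => ends; apply/(touching_itv circ1 num1 ts1 KE1 LE1 (nbh_neq0 u)).
  - by move: sd sd'; case: (side v); move: ai ij jb; clear; lia.
  - by move: sd sd'; case: (side v); move: ai ij jb; clear; lia.
  - by move: sd sd'; case: (side v); move: ai ij jb; clear; lia.
  - by move: sd sd'; case: (side v); move: ai ij jb bn mn; clear; lia.
  - by move: sd sd' ends; case: (side v); move: ai ij jb bn mn; clear; lia.
have [x0 x0E] : exists x, pos x = 0 by apply: (pos_surj num); exact: ltnW.
have [x1 x1E] : exists x, pos x = 1 by apply: (pos_surj num).
have [y0 y0E] : exists x, pos x = m by apply: (pos_surj num).
have [y1 y1E] : exists x, pos x = m.+1 by apply: (pos_surj num); move: nm1; clear; lia.
exists s1; split; first by rewrite /tight_arc_ordering ord1.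
- apply/eqP => s10; have := ts x0; have := ts1 x0; rewrite s10.
  by have := pos1P x0; have := pos1P (s0 x0); move: m1 mn x0E; clear; lia.
- apply/eqP => s10; have := ts (s1 y0); have := ts1 y0; rewrite s10 permKV.
  by have := pos1P y0; have := pos1P (s0^-1%g y0); move: m1 mn nm1 y0E; clear; lia.
move=> s s_tight; have circ : circular s by case/andP: s_tight => /andP [].
have circV := circularV circ.
have adjX u w : 0 <= pos u -> pos w = (pos u).+1 -> pos w < m -> s u = w \/ s w = u.
  by move=> _; exact: (block_adjacent s0_tight num ts XE mn s_tight).
have adjY u w : m <= pos u -> pos w = (pos u).+1 -> pos w < #|T| -> s u = w \/ s w = u.
  move=> mu uw wn; apply: (block_adjacent s0_tight num' ts' YE' mn' s_tight).
    by have := rot u; have := rot w; move: mu uw; clear; lia.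
  by have := rot w; move: mu uw wn mn; clear; lia.
have mT : m.+1 < #|T| by move: nm1; clear; lia.
have fX := forward_or_backward circ num (ltnW mn) m1 adjX.
have fY := forward_or_backward circ num (leqnn _) mT adjY.
have m0 := ltnW m1.
have same (t : {perm T}) : circular t ->
    (forall u w, 0 <= pos u -> pos w = (pos u).+1 -> pos w < m -> t u = w) ->
    (forall u w, m <= pos u -> pos w = (pos u).+1 -> pos w < #|T| -> t u = w) -> t = s0.
  move=> circt tX tY; apply: (turns_uniq num _ ts).
  apply: (forward_turns circt num m0 (ltnW mn)) => u w uw wm.
  have [wm'|mw] := ltnP (pos w) m; first exact: tX.
  by apply: tY => //; move: uw wm mw; clear; lia.
have flip (t : {perm T}) : circular t ->
    (forall u w, 0 <= pos u -> pos w = (pos u).+1 -> pos w < m -> t w = u) ->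
    (forall u w, m <= pos u -> pos w = (pos u).+1 -> pos w < #|T| -> t u = w) -> t = s1.
  move=> circt tX tY; apply: (turns_uniq num1 _ ts1).
  apply: (forward_turns circt num1 m0 (ltnW mn)) => u w uw wm.
  have := pos1P u; have := pos1P w => wP uP.
  have [wm'|mw] := ltnP (pos w) m.
    by apply: tX => //; move: uw wm wm' wP uP; clear; lia.
  by apply: tY => //; move: uw wm mw wP uP; clear; lia.
case: fX => fX; case: fY => fY.
- by constructor 1; apply: same.
- constructor 4; rewrite -[s]invgK; congr (_^-1)%g; apply: flip => // u w ku uw wm.
  by rewrite -(fX u w ku uw wm) permK.
- constructor 3; apply: flip => // u w ku uw wm.
  by rewrite -(fX u w ku uw wm) permKV.
- by constructor 2; rewrite -[s]invgK; congr (_^-1)%g; apply: same.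
Qed.

End Bipartite.

(** * Arcs of the circle *)

Section Geometry.

Variables (R : realType).
Implicit Types a b c d x : R.

Import Order.TTheory GRing.Theory Num.Theory.
Local Open Scope ring_scope.

Lemma in_circle_arc a b x : (x \in circle_arc a b) =
  (0 <= x < 1) && ((a <= x) && (x <= b) || (b < a) && ((a <= x) || (x <= b))).
Proof.
rewrite /circle_arc /on_circle /in_mem /=; congr andb.
case: (leP a b) => ab; first by rewrite orbF.
apply/idP/idP; lra.
Qed.

Lemma on_circleE x : on_circle x = (0 <= x < 1).
Proof. by []. Qed.

Lemma circle_arc_start a b : on_circle a -> a \in circle_arc a b.
Proof. by rewrite in_circle_arc on_circleE; case: (leP a b) => ?; lra. Qed.

Lemma circle_arcs_meet a b c d x : on_circle a -> on_circle c ->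
  x \in circle_arc a b -> x \in circle_arc c d ->
  (c \in circle_arc a b) || (a \in circle_arc c d).
Proof. by rewrite !in_circle_arc !on_circleE; case: (leP a c) => ?; lra. Qed.

Definition cyclic3 a b c := [|| a < b < c, b < c < a | c < a < b].

Lemma circle_arc_between a b c d : on_circle c -> cyclic3 a c d ->
  d \in circle_arc a b -> c \in circle_arc a b.
Proof. rewrite /cyclic3 !in_circle_arc !on_circleE; lra. Qed.

Lemma circle_arc_nested a b c d e : cyclic3 a c e -> e \in circle_arc a b ->
  e \notin circle_arc c d -> {subset circle_arc c d <= circle_arc a b}.
Proof. rewrite /cyclic3 => cyc eb ed x; move: cyc eb ed; rewrite !in_circle_arc; lra. Qed.

Lemma circle_arc_total a b d : {subset circle_arc a b <= circle_arc a d} \/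
  {subset circle_arc a d <= circle_arc a b}.
Proof.
have [ab|ba] := leP a b; have [ad|da] := leP a d; have [bd|db] := leP b d.
all: try by left => x; rewrite !in_circle_arc; lra.
all: by right => x; rewrite !in_circle_arc; lra.
Qed.

Lemma proper_circular_arc_round (T : finType) (e : rel T) :
  proper_circular_arc R e ->
  exists (r : rel T) (pos : T -> nat),
    [/\ forall u v, u != v -> e u v = r u v || r v u, numbering pos & round r pos].
Proof.
move=> [l [r [circ adj proper]]].
have lC v : on_circle (l v) by case: (circ v).
have l_inj : injective l.
  move=> u v uv; apply/eqP; apply: contraT => neq.
  have := circle_arc_total (l u) (r u) (r v); rewrite {2 3}uv => -[sub|sub].
    by case: (proper u v neq).
  by rewrite eq_sym in neq; case: (proper v u neq).
pose pos v := #|[set u | l u < l v]|.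
have pos_mono u v : l u < l v -> (pos u < pos v)%N.
  move=> uv; apply: proper_card; apply/properP; split.
    by apply/subsetP => x; rewrite !inE => /lt_trans; apply.
  by exists u; rewrite !inE ?ltxx.
have posE u v : (pos u < pos v)%N = (l u < l v).
  apply/idP/idP => [uv|]; last exact: pos_mono.
  rewrite ltNge le_eqVlt; apply/negP => /orP [/eqP /l_inj vu|/pos_mono].
    by rewrite vu ltnn in uv.
  by rewrite ltnNge ltnW.
exists (fun u v => l v \in circle_arc (l u) (r u)), pos; split.
- move=> u v uv; have [to from] := adj u v uv; apply/idP/idP => [/to [x [xu xv]]|].
    exact: circle_arcs_meet xu xv.
  case/orP => [vu|uv']; apply: from; [exists (l v)|exists (l u)]; split=> //;
    exact: circle_arc_start.
- split=> [u v uv|v].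
    by apply: l_inj; apply/eqP; rewrite eq_le !leNgt -!posE uv ltnn.
  rewrite -cardsT; apply: proper_card; apply/properP; split; first exact: subsetT.
  by exists v; rewrite !inE ?ltxx.
- move=> u w v; rewrite /cyclic_triple !posE => cyc uv; apply/andP; split.
    exact: circle_arc_between cyc uv.
  apply: contraT => wv; have wu : w != u by apply: contraNneq wv => ->.
  by case: (proper w u wu); exact: circle_arc_nested cyc uv wv.
Qed.

End Geometry.

Theorem theorem3p7 (R : realType) (T : finType) (e : rel T)
    (e_sym : symmetric e) (e_irr : irreflexive e)
    (e_twin_free : twin_free e) (e_conn : connected_graph e)
    (e_pca : proper_circular_arc R e) :
  (~ bipartite (compl_graph e) ->
     count_up_to_reversal (arc_ordering (nbh_hypergraph e)) = 1) /\
  (1 < #|T| ->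
   bipartite (compl_graph e) -> connected_graph (compl_graph e) ->
     count_up_to_reversal (tight_arc_ordering (nbh_hypergraph e)) = 2).
Proof.
have [r [pos [orientedP num rnd]]] := proper_circular_arc_round e_pca.
have [s0 [circ0 ts0]] := turn_numbering num.
have tight0 := round_tight_ordering orientedP circ0 num ts0 rnd.
split=> [nbip|n_gt1 [side sideP] c_conn]; rewrite /count_up_to_reversal.
  suff -> : [set [set s; s^-1%g] | s : {perm T} & arc_ordering (nbh_hypergraph e) s] =
    [set [set s0; s0^-1%g]] by rewrite cards1.
  apply/setP => C; rewrite inE; apply/imsetP/eqP => [[s sP ->]|->].
    rewrite in_set in sP.
    have [->|->] := arc_ordering_uniq e_sym e_irr orientedP e_conn e_twin_free nbip
      circ0 num ts0 rnd sP; first by [].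
    by rewrite invgK setUC.
  by exists s0; rewrite // in_set; case/andP: tight0.
have [s1 [tight1 s10 s10V classify]] :=
  two_tight_orderings e_sym e_irr e_conn e_twin_free c_conn n_gt1 sideP tight0.
suff -> : [set [set s; s^-1%g] | s : {perm T} & tight_arc_ordering (nbh_hypergraph e) s] =
    [set [set s0; s0^-1%g]; [set s1; s1^-1%g]].
  rewrite cards2; have [E|//] := eqVneq; have := set21 s1 s1^-1%g.
  by rewrite -E !inE (negPf s10) (negPf s10V).
apply/setP => C; rewrite in_set2; apply/imsetP/orP => [[s sP ->]|].
  rewrite in_set in sP; have [->|->|->|->] := classify s sP.
  - by left.
  - by left; rewrite invgK setUC.
  - by right.
  - by right; rewrite invgK setUC.
by case=> /eqP ->; [exists s0|exists s1]; rewrite // in_set.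
Qed.
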